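(* Let $q\in(0,1)$ and let $f(x;q)=\sum_{n\ge 0}\frac{x^n}{n!}q^{n(n-1)/2}$. Let $x_1(q)>x_2(q)>x_3(q)>\cdots$ denote the zeros of $x\mapsto f(x;q)$, so that $\cdots<x_{k+1}(q)<x_k(q)<\cdots<x_1(q)<0$. Then for every $k\ge 1$ and $q\in(0,1)$: \begin{align*} &\frac{\mathrm{d} x_k}{\mathrm{d} q}=\frac{x_k^2}{2}\sum_{j\ge 1}\frac{1}{x_j-qx_k},\\ &\sum_{j\ge 1}\frac{1}{x_k-qx_j}=0,\\ &(q-1)\,x_k=\prod_{\substack{j\ge 1\\ j\ne k}}\frac{x_j-x_k}{x_j-qx_k}, \end{align*} where $x_j=x_j(q)$.
   Context: For $q\in(0,1)$ the entire function $f(x;q)=\sum_{n\ge0}x^nq^{n(n-1)/2}/n!$ (the deformed exponential function) has infinitely many zeros, all of them simple and negative, and it admits the product representation $f(x;q)=\prod_{k\ge1}(1-x/x_k(q))$. Since the zeros are simple, each $x_k(q)$ is a differentiable (indeed analytic) function of $q\in(0,1)$. *)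

(* Defs.v *)
From Stdlib Require Import Reals.
From Coquelicot Require Import Coquelicot.
Open Scope R_scope.

(* Coefficients of the deformed exponential: q^(n(n-1)/2) / n!  (n(n-1) is even). *)
Definition dexp_coef (q : R) (n : nat) : R :=
  q ^ (n * (n - 1) / 2)%nat / INR (Factorial.fact n).

(* f(x;q) = sum_{n>=0} x^n q^{n(n-1)/2} / n!  (entire in x for 0<q<1). *)
Definition dexp (x q : R) : R := PSeries (dexp_coef q) x.

Fixpoint prod_except (a : nat -> R) (k n : nat) : R :=
  match n with
  | O => 1
  | S m => prod_except a k m * (if Nat.eqb m k then 1 else a m)
  end.

Definition is_prod_except (a : nat -> R) (k : nat) (p : R) : Prop :=
  is_lim_seq (fun n => prod_except a k n) p.

(* Main.v *)
(* Since [f'(x) = f(qx)], Rolle's theorem forces [x_{k+1} < x_k / q]: the zeros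
   are simple and [1 / |x_k|] decays geometrically. The polynomials
   [P_{N+1}(x) = P_N(x) + x P_N(qx)] have negative zeros separated in the same
   way, so [P_N(x/N) = prod (1 + r_i x)] with [0 <= r_i <= q^i], and [P_N(x/N)]
   tends to [f]. Separation makes its zeros converge one by one to those of [f],
   and by dominated convergence [f = prod (1 - x/x_k)] and
   [f'(y)/f(y) = sum 1/(y - x_j)]. With [f'(y) = f(qy)], this identity at
   [y = x_k/q] gives the second claim, and comparing the products for [f'(x_k)]
   and [f(q x_k)] the third. The first follows from the identity at [y = q x_k]
   by implicit differentiation, because [df/dq = (x^2/2) f(q^2 x)]. *)

Require Import Defs.
From Stdlib Require Import Reals Lra Lia IndefiniteDescription.
From Coquelicot Require Import Coquelicot.
Open Scope R_scope.

(** * Limits along filters and dominated convergence *)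

(** The obstacle is the factorization of [f], which Hadamard's theorem would give since [f] has
    order 0; here only real variables are used. Uniform convergence on compact real sets does not
    control complex zeros, so the approximants are chosen to split over the reals, with a summable
    bound on their inverse roots that does not depend on the degree. Explicitly [P_N(x)] is the sum
    of [binomial(N,n) q^(n(n-1)/2) x^n]. It satisfies [P_N'(x) = N P_{N-1}(qx)], so dividing the
    argument by [N] yields an exact finite analogue of [f'(x) = f(qx)] as well as the right
    coefficients in the limit. The bound [r_i <= q^i] comes from the linear coefficient: the [r_i]
    are positive with sum 1, so [r_0 <= 1], and separation does the rest. Limits are stated along
    arbitrary filters because the same stability result for zeros is used twice: as the degree tends
    to infinity, and as the parameter tends to [q]. *)

Lemma filterlim_R_eps (T : Type) (F : (T -> Prop) -> Prop) {FF : Filter F}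
  (u : T -> R) (l : R) :
  filterlim u F (locally l) <->
  (forall eps, 0 < eps -> F (fun t => Rabs (u t - l) < eps)).
Proof.
  split.
  - intros H eps He.
    exact (proj1 (filterlim_locally u l) H (mkposreal eps He)).
  - intros H; apply filterlim_locally; intros [eps He]; exact (H eps He).
Qed.

Lemma filterlim_R_plus (T : Type) (F : (T -> Prop) -> Prop) {FF : Filter F}
  (u v : T -> R) (a b : R) :
  filterlim u F (locally a) -> filterlim v F (locally b) ->
  filterlim (fun t => u t + v t) F (locally (a + b)).
Proof.
  intros Hu Hv; apply (@filterlim_comp_2 T R R R F _ _ _ FF u v Rplus Hu Hv).
  exact (@filterlim_plus R_AbsRing R_NormedModule a b).
Qed.

Lemma filterlim_R_mult (T : Type) (F : (T -> Prop) -> Prop) {FF : Filter F}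
  (u v : T -> R) (a b : R) :
  filterlim u F (locally a) -> filterlim v F (locally b) ->
  filterlim (fun t => u t * v t) F (locally (a * b)).
Proof.
  intros Hu Hv; apply (@filterlim_comp_2 T R R R F _ _ _ FF u v Rmult Hu Hv).
  exact (@filterlim_mult R_AbsRing a b).
Qed.

Lemma filterlim_R_comp (T : Type) (F : (T -> Prop) -> Prop)
  (u : T -> R) (h : R -> R) (a : R) :
  continuous h a -> filterlim u F (locally a) ->
  filterlim (fun t => h (u t)) F (locally (h a)).
Proof. intros Hh Hu; exact (filterlim_comp _ _ _ u h _ _ _ Hu Hh). Qed.

Lemma filterlim_R_opp (T : Type) (F : (T -> Prop) -> Prop)
  (u : T -> R) (a : R) :
  filterlim u F (locally a) -> filterlim (fun t => - u t) F (locally (- a)).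
Proof.
  apply (filterlim_R_comp T F u Ropp a).
  apply (@continuous_opp R_UniformSpace R_AbsRing R_NormedModule (fun x => x)).
  apply continuous_id.
Qed.

Lemma filterlim_R_abs (T : Type) (F : (T -> Prop) -> Prop)
  (u : T -> R) (a : R) :
  filterlim u F (locally a) -> filterlim (fun t => Rabs (u t)) F (locally (Rabs a)).
Proof. apply (filterlim_R_comp T F u Rabs a); apply continuous_Rabs. Qed.

Lemma filterlim_R_inv (T : Type) (F : (T -> Prop) -> Prop)
  (u : T -> R) (a : R) :
  a <> 0 -> filterlim u F (locally a) ->
  filterlim (fun t => / u t) F (locally (/ a)).
Proof.
  intros Ha; apply (filterlim_R_comp T F u Rinv a); now apply continuous_Rinv.
Qed.

Lemma filterlim_R_div (T : Type) (F : (T -> Prop) -> Prop) {FF : Filter F}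
  (u v : T -> R) (a b : R) :
  b <> 0 -> filterlim u F (locally a) -> filterlim v F (locally b) ->
  filterlim (fun t => u t / v t) F (locally (a / b)).
Proof.
  intros Hb Hu Hv; apply (filterlim_R_mult T F); [exact Hu|].
  now apply filterlim_R_inv.
Qed.

Lemma filterlim_R_lt (T : Type) (F : (T -> Prop) -> Prop) {FF : Filter F}
  (u : T -> R) (a b : R) :
  a < b -> filterlim u F (locally a) -> F (fun t => u t < b).
Proof.
  intros Hab Hu.
  assert (H := proj1 (filterlim_R_eps T F u a) Hu (b - a) ltac:(lra)).
  revert H; apply filter_imp; intros t Ht; apply Rabs_def2 in Ht; lra.
Qed.

Lemma filterlim_R_gt (T : Type) (F : (T -> Prop) -> Prop) {FF : Filter F}
  (u : T -> R) (a b : R) :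
  b < a -> filterlim u F (locally a) -> F (fun t => b < u t).
Proof.
  intros Hab Hu.
  assert (H := proj1 (filterlim_R_eps T F u a) Hu (a - b) ltac:(lra)).
  revert H; apply filter_imp; intros t Ht; apply Rabs_def2 in Ht; lra.
Qed.

Lemma filterlim_R_le (T : Type) (F : (T -> Prop) -> Prop) {FF : ProperFilter F}
  (u : T -> R) (a b : R) :
  F (fun t => u t <= b) -> filterlim u F (locally a) -> a <= b.
Proof.
  intros Hle Hu.
  apply (filterlim_le (F := F) u (fun _ => b) (Finite a) (Finite b) Hle Hu).
  apply (filterlim_const (U := R_UniformSpace)).
Qed.

Lemma filterlim_sum_f_R0 (T : Type) (F : (T -> Prop) -> Prop) {FF : Filter F}
  (a : T -> nat -> R) (l : nat -> R) (n : nat) :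
  (forall i, filterlim (fun t => a t i) F (locally (l i))) ->
  filterlim (fun t => sum_f_R0 (a t) n) F (locally (sum_f_R0 l n)).
Proof.
  intros H; induction n as [|n IH]; simpl; [apply H|].
  now apply filterlim_R_plus.
Qed.

Lemma Series_tail_le (a b : nat -> R) (n : nat) :
  ex_series b -> (forall i, (n < i)%nat -> Rabs (a i) <= b i) ->
  ex_series a /\
  Rabs (Series a - sum_f_R0 a n) <= Series b - sum_f_R0 b n.
Proof.
  intros Hb Hab.
  assert (Hb' := proj1 (ex_series_incr_n b (S n)) Hb).
  assert (Ha' : ex_series (fun k => Rabs (a (S n + k)%nat))).
  { refine (@ex_series_le R_AbsRing R_CompleteNormedModule _ _ _ Hb').
    intros i; unfold norm; simpl; unfold abs; simpl.
    rewrite Rabs_Rabsolu; apply Hab; lia. }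
  assert (Ha : ex_series a).
  { apply (ex_series_incr_n a (S n)), ex_series_Rabs, Ha'. }
  split; [exact Ha|].
  rewrite (Series_incr_n a (S n)), (Series_incr_n b (S n)) by (lia || easy).
  simpl pred.
  replace (_ + _ - _) with (Series (fun k => a (S n + k)%nat)) by ring.
  replace (_ + _ - _) with (Series (fun k => b (S n + k)%nat)) by ring.
  eapply Rle_trans; [apply Series_Rabs, Ha'|].
  apply Series_le; [|exact Hb'].
  intros i; split; [apply Rabs_pos|apply Hab; lia].
Qed.

Lemma Series_tail_small (b : nat -> R) (m : nat) (eps : R) :
  ex_series b -> 0 < eps ->
  exists n, (m <= n)%nat /\ Rabs (Series b - sum_f_R0 b n) < eps.
Proof.
  intros Hb He.
  assert (H := Series_correct b Hb); apply is_series_Reals in H.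
  destruct (H eps He) as [N HN].
  exists (max m N); split; [lia|].
  rewrite <- Rabs_Ropp; replace (- _) with (sum_f_R0 b (max m N) - Series b) by ring.
  apply HN; lia.
Qed.

(* Only a tail of the series needs to be dominated: the logarithmic derivative
   of a product has finitely many terms without a uniform bound. *)
Lemma tannery (T : Type) (F : (T -> Prop) -> Prop) {FF : ProperFilter F}
  (a : T -> nat -> R) (l b : nat -> R) (m : nat) :
  ex_series b ->
  F (fun t => forall n, (m <= n)%nat -> Rabs (a t n) <= b n) ->
  (forall n, filterlim (fun t => a t n) F (locally (l n))) ->
  ex_series l /\ filterlim (fun t => Series (a t)) F (locally (Series l)).
Proof.
  intros Hb Hab Hl.
  assert (Hlb : forall n, (m <= n)%nat -> Rabs (l n) <= b n).
  { intros n Hn; apply (filterlim_R_le T F (fun t => Rabs (a t n))).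
    - revert Hab; apply filter_imp; intros t Ht; now apply Ht.
    - now apply filterlim_R_abs. }
  split.
  { refine (proj1 (Series_tail_le l b m Hb _)); intros; apply Hlb; lia. }
  apply (filterlim_R_eps T F); intros eps He.
  (* One third for the partial sums up to [n] and one for each of the two tails; [m <= n] places
     both tails in the dominated range. *)
  destruct (Series_tail_small b m (eps / 3) Hb ltac:(lra)) as [n [Hmn Hn]].
  apply Rabs_def2 in Hn.
  assert (Hs := filterlim_sum_f_R0 T F a l n Hl).
  assert (Hs' := proj1 (filterlim_R_eps T F _ _) Hs (eps / 3) ltac:(lra)).
  generalize (filter_and _ _ Hs' Hab); apply filter_imp; intros t [Ht1 Ht2].
  destruct (Series_tail_le l b n Hb) as [_ H1]; [intros; apply Hlb; lia|].
  destruct (Series_tail_le (a t) b n Hb) as [_ H2]; [intros; apply Ht2; lia|].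
  apply Rabs_def2 in Ht1; apply Rabs_def1;
    apply Rabs_le_between in H1; apply Rabs_le_between in H2; lra.
Qed.

(** * The deformed exponential *)

Lemma triangular_S (n : nat) :
  (S n * (S n - 1) / 2 = n * (n - 1) / 2 + n)%nat.
Proof.
  rewrite <- Nat.div_add by lia; f_equal; nia.
Qed.

(** Coefficient form of [f'(x) = f(qx)]. It also gives the ratio test for [f] and the Pascal-type
    recurrence for the coefficients of [P_N]. *)
Lemma dexp_coef_S (q : R) (n : nat) :
  INR (S n) * dexp_coef q (S n) = q ^ n * dexp_coef q n.
Proof.
  unfold dexp_coef; rewrite triangular_S, pow_add, fact_simpl, mult_INR.
  assert (H := INR_fact_neq_0 n); assert (H' := not_0_INR (S n) ltac:(lia)).
  field; split; assumption.
Qed.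

Lemma dexp_coef_0 (q : R) : dexp_coef q 0 = 1.
Proof. unfold dexp_coef; simpl; field. Qed.

Lemma dexp_coef_pos (q : R) (n : nat) : 0 < q -> 0 < dexp_coef q n.
Proof.
  intros Hq; unfold dexp_coef; apply Rdiv_lt_0_compat.
  - now apply pow_lt.
  - apply INR_fact_lt_0.
Qed.

Lemma pow_le_1 (q : R) (n : nat) : 0 <= q <= 1 -> q ^ n <= 1.
Proof.
  intros Hq; rewrite <- (pow1 n); apply pow_incr; lra.
Qed.

Lemma dexp_coef_le (q : R) (n : nat) :
  0 < q < 1 -> dexp_coef q n <= / INR (Factorial.fact n).
Proof.
  intros Hq; unfold dexp_coef, Rdiv.
  rewrite <- (Rmult_1_l (/ INR (Factorial.fact n))) at 2.
  apply Rmult_le_compat_r.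
  - left; apply Rinv_0_lt_compat, INR_fact_lt_0.
  - apply pow_le_1; lra.
Qed.

Lemma ex_series_exp (x : R) :
  ex_series (fun n => / INR (Factorial.fact n) * x ^ n).
Proof. exists (exp x); apply (is_pseries_R _ x), is_exp_Reals. Qed.

Lemma ex_series_dominated_by_exp (c : nat -> R) (y : R) :
  (forall n, Rabs (c n) <= / INR (Factorial.fact n)) ->
  ex_series (fun n => c n * y ^ n).
Proof.
  intros Hc.
  refine (@ex_series_le R_AbsRing R_CompleteNormedModule _ _ _ (ex_series_exp (Rabs y))).
  intros n; unfold norm; simpl; unfold abs; simpl.
  rewrite Rabs_mult, RPow_abs; apply Rmult_le_compat_r; [apply Rabs_pos|apply Hc].
Qed.

Lemma dexp_coef_Rabs_le (q : R) (n : nat) :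
  0 < q < 1 -> Rabs (dexp_coef q n) <= / INR (Factorial.fact n).
Proof.
  intros Hq; rewrite Rabs_right; [now apply dexp_coef_le|].
  left; apply dexp_coef_pos; lra.
Qed.

Lemma CV_radius_dexp (q : R) : 0 < q < 1 -> CV_radius (dexp_coef q) = p_infty.
Proof.
  intros Hq; apply CV_radius_infinite_DAlembert.
  - intros n; apply Rgt_not_eq, dexp_coef_pos; lra.
  - apply (is_lim_seq_le_le (fun _ => 0) _ (fun n => q ^ n)).
    + intros n; split; [apply Rabs_pos|].
      assert (Hn := dexp_coef_pos q n ltac:(lra)).
      assert (Hm : 0 < INR (S n)) by (apply lt_0_INR; lia).
      assert (H1 : 1 <= INR (S n)) by (apply (le_INR 1); lia).
      replace (dexp_coef q (S n) / dexp_coef q n) with (q ^ n / INR (S n)).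
      2:{ assert (H := dexp_coef_S q n); field_simplify_eq; lra. }
      assert (Hp := pow_lt q n ltac:(lra)).
      rewrite Rabs_right by (left; now apply Rdiv_lt_0_compat).
      apply Rmult_le_reg_r with (INR (S n)); [lra|].
      unfold Rdiv; rewrite Rmult_assoc, Rinv_l, Rmult_1_r by lra; nra.
    + apply is_lim_seq_const.
    + apply is_lim_seq_geom; rewrite Rabs_right; lra.
Qed.

Lemma dexp_0 (q : R) : dexp 0 q = 1.
Proof. unfold dexp; rewrite PSeries_0; apply dexp_coef_0. Qed.

Lemma is_derive_dexp (q x : R) :
  0 < q < 1 -> is_derive (fun y => dexp y q) x (dexp (q * x) q).
Proof.
  intros Hq; unfold dexp.
  replace (PSeries (dexp_coef q) (q * x)) with (PSeries (PS_derive (dexp_coef q)) x).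
  - apply (is_derive_PSeries (dexp_coef q) x).
    rewrite CV_radius_dexp by assumption; exact I.
  - unfold PSeries; apply Series_ext; intros n; unfold PS_derive.
    rewrite dexp_coef_S, Rpow_mult_distr; ring.
Qed.

Lemma continuous_dexp (q x : R) :
  0 < q < 1 -> continuous (fun y => dexp y q) x.
Proof.
  intros Hq; apply (ex_derive_continuous (K := R_AbsRing) (V := R_NormedModule)).
  eexists; now apply is_derive_dexp.
Qed.

(** For [|y| <= M] the difference is at most the sum of [|a t n - l n| |M|^n], which no longer
    involves [y]; Tannery with majorant [2 |M|^n / n!] sends it to 0. *)
Lemma pseries_filterlim_unif (T : Type) (F : (T -> Prop) -> Prop)
  {FF : ProperFilter F} (a : T -> nat -> R) (l : nat -> R) (M eps : R) :
  0 < eps ->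
  F (fun t => forall n, Rabs (a t n) <= / INR (Factorial.fact n)) ->
  (forall n, Rabs (l n) <= / INR (Factorial.fact n)) ->
  (forall n, filterlim (fun t => a t n) F (locally (l n))) ->
  F (fun t => forall y, Rabs y <= M -> Rabs (PSeries (a t) y - PSeries l y) < eps).
Proof.
  intros He Ha Hl Hlim.
  set (d := fun t n => Rabs (a t n - l n) * Rabs M ^ n).
  set (b := fun n => 2 * (/ INR (Factorial.fact n) * Rabs M ^ n)).
  assert (Hb : ex_series b).
  { apply (ex_series_scal_l (V := R_NormedModule) 2), ex_series_exp. }
  assert (Hd : forall t, (forall n, Rabs (a t n) <= / INR (Factorial.fact n)) ->
    forall n, 0 <= d t n <= b n).
  { intros t Ht n; unfold d, b.
    assert (HM := pow_le (Rabs M) n (Rabs_pos M)).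
    split; [apply Rmult_le_pos; [apply Rabs_pos|exact HM]|].
    rewrite <- Rmult_assoc; apply Rmult_le_compat_r; [exact HM|].
    eapply Rle_trans; [apply Rabs_triang|]; rewrite Rabs_Ropp.
    specialize (Ht n); specialize (Hl n); lra. }
  destruct (tannery T F d (fun _ => 0) b 0 Hb) as [_ Hlim0].
  - revert Ha; apply filter_imp; intros t Ht n _.
    rewrite Rabs_right; [|apply Rle_ge]; now apply Hd.
  - intros n; unfold d.
    replace (locally 0) with (locally (0 * Rabs M ^ n)) by (f_equal; ring).
    apply (filterlim_R_mult T F); [|apply (filterlim_const (U := R_UniformSpace))].
    apply (filterlim_R_eps T F); intros e He'.
    assert (H := proj1 (filterlim_R_eps T F _ _) (Hlim n) e He').
    revert H; apply filter_imp; intros t Ht.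
    now rewrite Rminus_0_r, Rabs_Rabsolu.
  (* The zero terms are written [0 * 0] so that pulling out the scalar evaluates the series to 0. *)
  - rewrite (Series_ext _ (fun _ => 0 * 0)), Series_scal_l, Rmult_0_l in Hlim0
      by (intros; ring).
    assert (H := filterlim_R_lt T F _ _ eps He Hlim0).
    generalize (filter_and _ _ H Ha); apply filter_imp; intros t [Ht Hat] y Hy.
    eapply Rle_lt_trans; [|exact Ht].
    unfold PSeries; rewrite <- Series_minus
      by (apply ex_series_dominated_by_exp; assumption).
    assert (Hterm : forall n, 0 <= Rabs (a t n * y ^ n - l n * y ^ n) <= d t n).
    { intros n; split; [apply Rabs_pos|]; unfold d.
      rewrite <- Rmult_minus_distr_r, Rabs_mult, <- RPow_abs.
      apply Rmult_le_compat_l; [apply Rabs_pos|].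
      apply pow_incr; split; [apply Rabs_pos|].
      eapply Rle_trans; [exact Hy|apply Rle_abs]. }
    assert (Hds : ex_series (d t)).
    { refine (@ex_series_le R_AbsRing R_CompleteNormedModule _ _ _ Hb).
      intros n; unfold norm; simpl; unfold abs; simpl.
      rewrite Rabs_right; [|apply Rle_ge]; now apply Hd. }
    eapply Rle_trans; [apply Series_Rabs|now apply Series_le].
    refine (@ex_series_le R_AbsRing R_CompleteNormedModule _ _ _ Hds).
    intros n; unfold norm; simpl; unfold abs; simpl.
    rewrite Rabs_Rabsolu; apply Hterm.
Qed.

(** This Lipschitz bound dominates the difference quotients of [t ^ m] uniformly in [t], which is
    what differentiating [f] termwise in [q] requires. *)
Lemma pow_diff_le (s t : R) (m : nat) :
  0 <= s <= 1 -> 0 <= t <= 1 -> Rabs (s ^ m - t ^ m) <= INR m * Rabs (s - t).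
Proof.
  intros Hs Ht; induction m as [|m IH].
  - simpl; rewrite Rminus_diag, Rabs_R0; lra.
  - rewrite S_INR; simpl.
    replace (s * s ^ m - t * t ^ m) with (s * (s ^ m - t ^ m) + (s - t) * t ^ m) by ring.
    eapply Rle_trans; [apply Rabs_triang|].
    rewrite !Rabs_mult, (Rabs_right s), (Rabs_right (t ^ m))
      by (try apply Rle_ge, pow_le; lra).
    assert (H1 := pow_le_1 t m Ht); assert (H2 := pow_le t m (proj1 Ht)).
    assert (H3 := Rabs_pos (s - t)); assert (H4 := Rabs_pos (s ^ m - t ^ m)); nra.
Qed.

Lemma locally_unit_interval (q : R) :
  0 < q < 1 -> locally q (fun t => 0 < t < 1).
Proof.
  intros Hq; apply (open_and (fun t => 0 < t) (fun t => t < 1)); [| |exact Hq].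
  - apply open_gt.
  - apply open_lt.
Qed.

Lemma dexp_filterlim_unif (q M eps : R) :
  0 < q < 1 -> 0 < eps ->
  locally q (fun t => forall y, Rabs y <= M -> Rabs (dexp y t - dexp y q) < eps).
Proof.
  intros Hq He.
  apply (pseries_filterlim_unif R (locally q) dexp_coef); [assumption| | |].
  - generalize (locally_unit_interval q Hq); apply filter_imp; intros t Ht n.
    now apply dexp_coef_Rabs_le.
  - intros n; now apply dexp_coef_Rabs_le.
  - intros n; unfold dexp_coef.
    apply (filterlim_R_mult R (locally q)); [|apply (filterlim_const (U := R_UniformSpace))].
    apply (ex_derive_continuous (K := R_AbsRing) (V := R_NormedModule)).
    auto_derive; easy.
Qed.

(** Source of the factor [x^2/2] in [df/dq]: the exponent [n(n-1)/2] brought down by differentiation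
    cancels the top two factors of [n!]. *)
Lemma INR_triangular_SS (k : nat) :
  INR (S (S k) * (S (S k) - 1) / 2) * / INR (Factorial.fact (S (S k)))
  = / 2 * / INR (Factorial.fact k).
Proof.
  assert (H : INR (S (S k) * (S (S k) - 1) / 2) = INR (S (S k)) * INR (S k) / 2).
  { assert (Hd : (2 * (S (S k) * (S (S k) - 1) / 2) = S (S k) * S k)%nat).
    { assert (Hk : exists c, (S (S k) * S k = c * 2)%nat).
      { destruct (Nat.Even_or_Odd k) as [[c Hc]|[c Hc]];
          [exists (S c * S k)%nat|exists (S (S k) * S c)%nat]; subst; nia. }
      destruct Hk as [c Hk]; replace (S (S k) - 1)%nat with (S k) by lia.
      rewrite Hk, Nat.div_mul; lia. }
    apply (f_equal INR) in Hd; rewrite !mult_INR in Hd; simpl (INR 2) in Hd; lra. }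
  rewrite H, !fact_simpl, !mult_INR.
  assert (H0 := INR_fact_neq_0 k).
  assert (H1 := not_0_INR (S k) ltac:(lia)); assert (H2 := not_0_INR (S (S k)) ltac:(lia)).
  field; auto.
Qed.

(** Termwise differentiation in [q] by Tannery. After a shift by two, the majorant
    [n(n-1)/2 |y|^n / n!] is [|y|^2/2] times an exponential series. *)
Lemma dexp_quotient_q_filterlim (q y : R) :
  0 < q < 1 ->
  filterlim (fun t => (dexp y t - dexp y q) / (t - q)) (locally' q)
    (locally (y ^ 2 / 2 * dexp (q ^ 2 * y) q)).
Proof.
  intros Hq.
  set (tr := fun n => (n * (n - 1) / 2)%nat).
  set (a := fun t n => (t ^ tr n - q ^ tr n) / (t - q) * / INR (Factorial.fact n) * y ^ n).
  set (l := fun n => INR (tr n) * q ^ pred (tr n) * / INR (Factorial.fact n) * y ^ n).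
  set (b := fun n => INR (tr n) * / INR (Factorial.fact n) * Rabs y ^ n).
  assert (Hex : forall z, 0 < z < 1 -> ex_series (fun n => dexp_coef z n * y ^ n)).
  { intros z Hz; apply ex_series_dominated_by_exp; intros n; now apply dexp_coef_Rabs_le. }
  assert (Hb : ex_series b).
  { apply (ex_series_incr_n b 2).
    apply ex_series_ext with
      (fun k => Rabs y ^ 2 / 2 * (/ INR (Factorial.fact k) * Rabs y ^ k)).
    - intros k; unfold b, tr; change (2 + k)%nat with (S (S k)).
      rewrite INR_triangular_SS; simpl; field; apply INR_fact_neq_0.
    - apply (ex_series_scal_l (V := R_NormedModule)), ex_series_exp. }
  assert (Hnear : locally' q (fun t => 0 < t < 1 /\ t <> q)).
  { unfold locally', within; generalize (locally_unit_interval q Hq).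
    apply filter_imp; tauto. }
  assert (Hproper : ProperFilter (locally' q)) by exact (Rbar_locally'_filter (Finite q)).
  destruct (tannery R (locally' q) a l b 0 Hb) as [Hl Hlim].
  - revert Hnear; apply filter_imp; intros t [Ht Htq] n _; unfold a, b, Rdiv.
    rewrite !Rabs_mult, RPow_abs.
    apply Rmult_le_compat_r; [apply Rabs_pos|].
    assert (Hf := Rinv_0_lt_compat _ (INR_fact_lt_0 n)).
    rewrite (Rabs_right (/ INR _)) by lra.
    apply Rmult_le_compat_r; [lra|].
    rewrite Rabs_inv; apply Rmult_le_reg_r with (Rabs (t - q)).
    + apply Rabs_pos_lt; lra.
    + rewrite Rmult_assoc, Rinv_l by (apply Rabs_no_R0; lra).
      rewrite Rmult_1_r; apply pow_diff_le; lra.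
  - intros n; unfold a, l.
    apply (filterlim_R_mult R (locally' q)); [|apply (filterlim_const (U := R_UniformSpace))].
    apply (filterlim_R_mult R (locally' q)); [|apply (filterlim_const (U := R_UniformSpace))].
    apply (filterlim_R_eps R (locally' q)); intros eps He.
    destruct (derivable_pt_lim_pow q (tr n) eps He) as [delta Hd].
    exists delta; intros t Ht Htq.
    replace t with (q + (t - q)) at 1 by ring.
    apply Hd; [lra|exact Ht].
  - replace (y ^ 2 / 2 * dexp (q ^ 2 * y) q) with (Series l).
    + revert Hlim; apply filterlim_ext_loc.
      revert Hnear; apply filter_imp; intros t [Ht Htq].
      unfold dexp, PSeries.
      rewrite <- Series_minus by now apply Hex.
      unfold Rdiv; rewrite <- Series_scal_r; apply Series_ext; intros n.
      unfold a, dexp_coef, tr, Rdiv; ring.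
    (* The terms 0 and 1 have exponent 0 in [q] and drop out. For [n = k + 2] the exponent minus one
       is [k(k-1)/2 + 2k], and the extra [q^(2k)] moves the argument to [q^2 y]. *)
    + rewrite (Series_incr_n l 2 ltac:(lia) Hl); simpl sum_f_R0.
      unfold l at 1 2; change (tr 0%nat) with 0%nat; change (tr 1%nat) with 0%nat.
      rewrite !Rmult_0_l, !Rplus_0_l.
      unfold dexp, PSeries; rewrite <- Series_scal_l; apply Series_ext; intros k.
      change (2 + k)%nat with (S (S k)); unfold l, tr.
      replace (pred (S (S k) * (S (S k) - 1) / 2)) with (k * (k - 1) / 2 + (k + k))%nat
        by (rewrite !triangular_S; lia).
      replace (INR _ * _ * _) with
        (INR (S (S k) * (S (S k) - 1) / 2) * / INR (Factorial.fact (S (S k)))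
          * q ^ (k * (k - 1) / 2 + (k + k))) by ring.
      rewrite INR_triangular_SS; unfold dexp_coef.
      rewrite Rpow_mult_distr, <- (pow_mult q 2 k).
      replace (2 * k)%nat with (k + k)%nat by lia.
      rewrite (pow_add q (_ / 2)); simpl; field; apply INR_fact_neq_0.
Qed.

(** * Separation and stability of zeros *)

Definition enumerates_zeros (f : R -> R) (z : nat -> R) : Prop :=
  z 0%nat < 0 /\ (forall k, z (S k) < z k) /\
  (forall y, f y = 0 <-> exists k, z k = y).

Lemma decreasing_le (z : nat -> R) (i j : nat) :
  (forall k, z (S k) < z k) -> (i <= j)%nat -> z j <= z i.
Proof.
  intros Hz Hij; induction Hij as [|j _ IH]; [lra|]; specialize (Hz j); lra.
Qed.

Lemma decreasing_lt_inv (z : nat -> R) (i j : nat) :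
  (forall k, z (S k) < z k) -> z j < z i -> (i < j)%nat.
Proof.
  intros Hz Hij; destruct (Nat.le_gt_cases j i) as [H|H]; [|lia].
  assert (H' := decreasing_le z j i Hz H); lra.
Qed.

Lemma enumerates_zeros_root (f : R -> R) (z : nat -> R) (k : nat) :
  enumerates_zeros f z -> f (z k) = 0.
Proof. intros [_ [_ H]]; apply H; now exists k. Qed.

Lemma enumerates_zeros_neg (f : R -> R) (z : nat -> R) (k : nat) :
  enumerates_zeros f z -> z k < 0.
Proof.
  intros [H0 [Hd _]]; assert (H := decreasing_le z 0 k Hd ltac:(lia)); lra.
Qed.

Lemma enumerates_zeros_gap (f : R -> R) (z : nat -> R) (k : nat) (y : R) :
  enumerates_zeros f z -> f y = 0 -> y <= z (S k) \/ z k <= y.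
Proof.
  intros [_ [Hd Hz]] Hy; apply Hz in Hy; destruct Hy as [j <-].
  destruct (Nat.le_gt_cases j k) as [H|H];
    [right|left]; apply decreasing_le; auto with arith.
Qed.

(* Rolle gives a zero [x_j / q] of [f'(x) = f(qx)] in each gap of the zeros of
   [f]; since [x_j > x_j / q] the only possible choice is [j = k]. *)
Lemma zeros_separated (q : R) (z : nat -> R) (k : nat) :
  0 < q < 1 -> enumerates_zeros (fun y => dexp y q) z -> z (S k) < z k / q.
Proof.
  intros Hq Hz.
  induction k as [k IH] using (well_founded_induction Nat.lt_wf_0).
  assert (Hneg := fun i => enumerates_zeros_neg _ _ i Hz).
  assert (Hroot := fun i => enumerates_zeros_root _ _ i Hz); simpl in Hroot.
  destruct Hz as [_ [Hd Hz]].
  assert (Hlt := Hd k).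
  destruct (MVT_cor2 (fun y => dexp y q) (fun y => dexp (q * y) q) _ _ Hlt)
    as [c [Hc Hcin]].
  { intros c _; apply is_derive_Reals; now apply is_derive_dexp. }
  rewrite !Hroot in Hc.
  assert (Hc0 : dexp (q * c) q = 0) by nra.
  apply Hz in Hc0; destruct Hc0 as [j Hj].
  assert (Hcj : z j / q = c) by (rewrite Hj; field; lra).
  assert (Hjk : (j < S k)%nat).
  { apply (decreasing_lt_inv z); [exact Hd|]; specialize (Hneg j); nra. }
  destruct (Nat.eq_dec j k) as [->|Hne]; [lra|].
  (* For [j < k] the point [c = z j / q] lies below [z k <= z (S j)], while the induction hypothesis
     puts it above [z (S j)]. *)
  assert (Hjk' := IH j ltac:(lia)).
  assert (H := decreasing_le z (S j) k Hd ltac:(lia)); lra.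
Qed.

(** Here [dexp (q * z k) q] is the derivative at [z k]. If it vanished, [z k] would equal some
    [z j / q], a point strictly inside the gap between [z (S j)] and [z j]. *)
Lemma zeros_simple (q : R) (z : nat -> R) (k : nat) :
  0 < q < 1 -> enumerates_zeros (fun y => dexp y q) z -> dexp (q * z k) q <> 0.
Proof.
  intros Hq Hz H0.
  assert (Hn := enumerates_zeros_neg _ _ k Hz).
  destruct (proj1 (proj2 (proj2 Hz) _) H0) as [j Hj].
  assert (Hs := zeros_separated q z j Hq Hz).
  assert (Hjn := enumerates_zeros_neg _ _ j Hz).
  assert (Hjk : z j / q = z k) by (rewrite Hj; field; lra).
  assert (Hk := enumerates_zeros_root _ _ k Hz).
  destruct (enumerates_zeros_gap _ _ j _ Hz Hk) as [H|H]; nra.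
Qed.

Lemma sign_change_at_simple_zero (f : R -> R) (c L eps : R) :
  is_derive f c L -> L <> 0 -> f c = 0 -> 0 < eps ->
  exists u v, c - eps < u < c /\ c < v < c + eps /\ f u * f v < 0.
Proof.
  intros Hf HL Hc He; apply is_derive_Reals in Hf.
  (* With tolerance [|L|] the difference quotients on both sides have the sign of [L], so the values
     at [c - h] and [c + h] have opposite signs. *)
  destruct (Hf (Rabs L) (Rabs_pos_lt _ HL)) as [delta Hd].
  set (h := Rmin (delta / 2) (eps / 2)).
  assert (Hdp := cond_pos delta).
  assert (Hh : 0 < h) by (apply Rmin_pos; lra).
  assert (Hh1 : h <= delta / 2) by apply Rmin_l.
  assert (Hh2 : h <= eps / 2) by apply Rmin_r.
  exists (c + - h), (c + h); split; [lra|]; split; [lra|].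
  assert (H1 := Hd h ltac:(lra) ltac:(rewrite Rabs_right; lra)).
  assert (H2 := Hd (- h) ltac:(lra) ltac:(rewrite Rabs_Ropp, Rabs_right; lra)).
  rewrite Hc, Rminus_0_r in H1, H2.
  set (A := f (c + h) / h) in *; set (B := f (c + - h) / - h) in *.
  assert (HA : f (c + h) = A * h) by (unfold A; field; lra).
  assert (HB : f (c + - h) = - B * h) by (unfold B; field; lra).
  rewrite HA, HB.
  assert (HAB : 0 < A * B).
  { destruct (Rtotal_order L 0) as [HL'|[HL'|HL']]; [|lra|].
    - rewrite (Rabs_left L) in H1, H2 by lra.
      apply Rabs_def2 in H1; apply Rabs_def2 in H2; nra.
    - rewrite (Rabs_right L) in H1, H2 by lra.
      apply Rabs_def2 in H1; apply Rabs_def2 in H2; nra. }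
  assert (Hhh := Rmult_lt_0_compat _ _ HAB (Rmult_lt_0_compat _ _ Hh Hh)); lra.
Qed.

Definition converges_unif_on_compacts {T : Type} (F : (T -> Prop) -> Prop)
  (g : T -> R -> R) (f : R -> R) : Prop :=
  forall M eps, 0 < eps ->
    F (fun t => forall y, Rabs y <= M -> Rabs (g t y - f y) < eps).

(** By compactness [|f|] has a positive minimum on the interval, and this minimum serves as the
    tolerance for the uniform convergence. *)
Lemma unif_limit_nonzero (T : Type) (F : (T -> Prop) -> Prop) {FF : Filter F}
  (g : T -> R -> R) (f : R -> R) (a b : R) :
  converges_unif_on_compacts F g f ->
  (forall y, continuous f y) ->
  (forall y, a <= y <= b -> f y <> 0) ->
  F (fun t => forall y, a <= y <= b -> g t y <> 0).
Proof.
  intros Hg Hf Hab.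
  destruct (Rle_dec a b) as [Hle|Hgt].
  2:{ apply filter_forall; intros t y Hy; lra. }
  destruct (continuity_ab_min (fun y => Rabs (f y)) a b Hle) as [m [Hm Hmab]].
  { intros c _; apply continuity_pt_filterlim.
    apply (filterlim_R_abs R (locally c)), Hf. }
  assert (Hm0 := Rabs_pos_lt _ (Hab m Hmab)).
  generalize (Hg (Rmax (Rabs a) (Rabs b)) _ Hm0); apply filter_imp.
  intros t Ht y Hy H0.
  assert (HyM : Rabs y <= Rmax (Rabs a) (Rabs b)) by now apply RmaxAbs.
  specialize (Ht y HyM); specialize (Hm y Hy).
  rewrite H0, Rminus_0_l, Rabs_Ropp in Ht; lra.
Qed.

Lemma unif_limit_sign_change (T : Type) (F : (T -> Prop) -> Prop) {FF : Filter F}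
  (g : T -> R -> R) (f : R -> R) (u v : R) :
  converges_unif_on_compacts F g f ->
  F (fun t => continuity (g t)) ->
  u < v -> f u * f v < 0 ->
  F (fun t => exists y, u <= y <= v /\ g t y = 0).
Proof.
  intros Hg Hc Huv Hf.
  assert (Hu : f u <> 0) by nra; assert (Hv : f v <> 0) by nra.
  assert (H1 := Hg (Rabs u) _ (Rabs_pos_lt _ Hu)).
  assert (H2 := Hg (Rabs v) _ (Rabs_pos_lt _ Hv)).
  generalize (filter_and _ _ Hc (filter_and _ _ H1 H2)); apply filter_imp.
  intros t [Hct [Ht1 Ht2]].
  specialize (Ht1 u (Rle_refl _)); specialize (Ht2 v (Rle_refl _)).
  assert (Hs : g t u * g t v <= 0).
  { unfold Rabs in Ht1, Ht2;
    repeat destruct Rcase_abs in Ht1; repeat destruct Rcase_abs in Ht2; nra. }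
  destruct (IVT_cor (g t) u v Hct (Rlt_le _ _ Huv) Hs) as [y Hy].
  now exists y.
Qed.

(** A real counterpart of Hurwitz's theorem, for [z t] the largest zero of [g t] up to [b]. It
    cannot stay in [[c + eps, b]], where [f] is bounded away from 0; and the sign change of [f] at
    [c] gives [g t] a zero near [c], below which [z t] cannot fall. *)
Lemma simple_zero_filterlim (T : Type) (F : (T -> Prop) -> Prop) {FF : Filter F}
  (g : T -> R -> R) (f : R -> R) (c b L : R) (z : T -> R) :
  converges_unif_on_compacts F g f ->
  F (fun t => continuity (g t)) ->
  (forall y, continuous f y) ->
  is_derive f c L -> L <> 0 -> f c = 0 -> c < b ->
  (forall y, c < y <= b -> f y <> 0) ->
  F (fun t => g t (z t) = 0) ->
  F (fun t => z t <= b) ->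
  F (fun t => forall y, g t y = 0 -> y <= z t \/ b < y) ->
  filterlim z F (locally c).
Proof.
  intros Hg Hgc Hf HL HL0 Hc0 Hcb Hfb Hz Hzb Hgap.
  apply (filterlim_R_eps T F); intros eps He.
  assert (H1 : F (fun t => forall y, c + eps <= y <= b -> g t y <> 0)).
  { apply (unif_limit_nonzero T F g f); auto; intros y Hy; apply Hfb; lra. }
  destruct (sign_change_at_simple_zero f c L (Rmin eps (b - c)) HL HL0 Hc0)
    as [u [v [Hu [Hv Huv]]]]; [apply Rmin_pos; lra|].
  assert (Hm1 := Rmin_l eps (b - c)); assert (Hm2 := Rmin_r eps (b - c)).
  assert (H2 := unif_limit_sign_change T F g f u v Hg Hgc ltac:(lra) Huv).
  generalize (filter_and _ _ (filter_and _ _ H1 H2)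
    (filter_and _ _ Hz (filter_and _ _ Hzb Hgap))); apply filter_imp.
  intros t [[Ht1 [y [Hy Hy0]]] [Ht2 [Ht3 Ht4]]].
  apply Rabs_def1.
  - destruct (Rlt_le_dec (z t - c) eps) as [H|H]; [exact H|].
    exfalso; apply (Ht1 (z t)); [lra|exact Ht2].
  - destruct (Ht4 y Hy0); lra.
Qed.

(* The uniform separation of the [z i t] keeps two of them from merging into
   the same zero of [f], so the numbering is preserved in the limit. *)
Lemma separated_zeros_filterlim (T : Type) (F : (T -> Prop) -> Prop) {FF : Filter F}
  (g : T -> R -> R) (f df : R -> R) (z : nat -> T -> R) (x : nat -> R) (s : R) :
  converges_unif_on_compacts F g f ->
  F (fun t => continuity (g t)) ->
  (forall y, is_derive f y (df y)) ->
  (forall k, df (x k) <> 0) ->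
  enumerates_zeros f x -> f 0 <> 0 ->
  0 < s < 1 ->
  F (fun t => z 0%nat t < 0) ->
  (forall k, F (fun t => z (S k) t <= z k t / s)) ->
  (forall k, F (fun t => g t (z k t) = 0)) ->
  F (fun t => forall y, g t y = 0 -> y <= z 0%nat t) ->
  (forall k, F (fun t => forall y, g t y = 0 -> y <= z (S k) t \/ z k t <= y)) ->
  forall k, filterlim (z k) F (locally (x k)).
Proof.
  intros Hg Hgc Hdf Hsimple Hx Hf0 Hs Hz0 Hsep Hroot Htop Hgap k.
  assert (Hf : forall y, continuous f y).
  { intros y; apply (ex_derive_continuous (K := R_AbsRing) (V := R_NormedModule)).
    eexists; apply Hdf. }
  induction k as [|k IH].
  - apply (simple_zero_filterlim T F g f (x 0%nat) 0 (df (x 0%nat))); auto.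
    + now apply enumerates_zeros_root.
    + now apply (enumerates_zeros_neg f).
    + intros y Hy H; destruct Hx as [_ [Hd Hx]]; apply Hx in H.
      destruct H as [j Hj]; assert (H := decreasing_le x 0 j Hd ltac:(lia)); lra.
    + revert Hz0; apply filter_imp; intros; lra.
    + revert Htop; apply filter_imp; intros t Ht y Hy; left; now apply Ht.
  - assert (Hn := enumerates_zeros_neg f x k Hx).
    assert (Hlt := proj1 (proj2 Hx) k).
    assert (Hss : x k / s < x k).
    { apply Rmult_lt_reg_r with s; [lra|]; unfold Rdiv.
      rewrite Rmult_assoc, Rinv_l by lra; nra. }
    (* The barrier [b] must separate [x (S k)] from [x k] and exceed [x k / s], the limit of the
       upper bound on [z (S k) t]. The larger of the two midpoints does both. *)
    set (b := Rmax ((x (S k) + x k) / 2) ((x k / s + x k) / 2)).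
    assert (Hb1 : (x (S k) + x k) / 2 <= b) by apply Rmax_l.
    assert (Hb2 : (x k / s + x k) / 2 <= b) by apply Rmax_r.
    assert (Hb3 : b < x k) by (apply Rmax_lub_lt; lra).
    assert (Hlim : filterlim (fun t => z k t / s) F (locally (x k / s))).
    { apply (filterlim_R_mult T F); [exact IH|].
      apply (filterlim_const (U := R_UniformSpace)). }
    apply (simple_zero_filterlim T F g f (x (S k)) b (df (x (S k)))); auto.
    + now apply enumerates_zeros_root.
    + lra.
    + intros y Hy H; destruct (enumerates_zeros_gap f x k y Hx H); lra.
    + assert (Hb4 : x k / s < b) by lra.
      generalize (filter_and _ _ (Hsep k) (filterlim_R_lt T F _ _ b Hb4 Hlim)).
      apply filter_imp; intros t [H1 H2]; lra.
    + generalize (filter_and _ _ (Hgap k) (filterlim_R_gt T F _ _ b Hb3 IH)).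
      apply filter_imp; intros t [H1 H2] y Hy; destruct (H1 y Hy); [left|right]; lra.
Qed.

(** * Real-rooted polynomial approximations *)

Fixpoint prod_first (a : nat -> R) (n : nat) : R :=
  match n with
  | O => 1
  | S m => prod_first a m * a m
  end.

Lemma prod_first_ext (a b : nat -> R) (n : nat) :
  (forall i, (i < n)%nat -> a i = b i) -> prod_first a n = prod_first b n.
Proof.
  intros H; induction n as [|n IH]; simpl; [easy|].
  rewrite IH, H by auto with arith; easy.
Qed.

Lemma prod_first_eq_0 (a : nat -> R) (i n : nat) :
  (i < n)%nat -> a i = 0 -> prod_first a n = 0.
Proof.
  intros Hin Ha; induction n as [|n IH]; [lia|]; simpl.
  destruct (Nat.eq_dec i n) as [<-|Hne]; [rewrite Ha; ring|].
  rewrite IH by lia; ring.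
Qed.

Lemma prod_first_0_inv (a : nat -> R) (n : nat) :
  prod_first a n = 0 -> exists i, (i < n)%nat /\ a i = 0.
Proof.
  induction n as [|n IH]; simpl; intros H; [lra|].
  destruct (Rmult_integral _ _ H) as [H'|H'].
  - destruct (IH H') as [i [Hi Hi']]; exists i; auto with arith.
  - exists n; auto with arith.
Qed.

Lemma prod_first_sign (a : nat -> R) (m n : nat) :
  (m <= n)%nat -> (forall i, (i < m)%nat -> a i < 0) ->
  (forall i, (m <= i < n)%nat -> 0 < a i) -> 0 < (-1) ^ m * prod_first a n.
Proof.
  intros Hmn Hneg; induction Hmn as [|n Hmn IH]; intros Hpos.
  - clear Hpos; induction m as [|m IH]; simpl; [lra|].
    assert (H := IH ltac:(auto with arith)); specialize (Hneg m ltac:(lia)); nra.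
  - simpl; assert (H := IH ltac:(intros; apply Hpos; lia)).
    specialize (Hpos n ltac:(lia)); nra.
Qed.

(** Polynomials of degree at most [n] in Horner form, as functions: splitting off a root is then a
    plain induction, with no coefficient lists. *)
Fixpoint is_poly (n : nat) (f : R -> R) : Prop :=
  match n with
  | O => exists c, forall x, f x = c
  | S m => exists c g, is_poly m g /\ forall x, f x = c + x * g x
  end.

Lemma is_poly_S (n : nat) (f : R -> R) : is_poly n f -> is_poly (S n) f.
Proof.
  revert f; induction n as [|n IH]; intros f.
  - intros [c Hc]; exists c, (fun _ => 0); split; [now exists 0|].
    intros x; rewrite Hc; ring.
  - intros [c [g [Hg Hf]]]; exists c, g; split; [now apply IH|exact Hf].
Qed.

Lemma is_poly_plus (n : nat) (f g : R -> R) :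
  is_poly n f -> is_poly n g -> is_poly n (fun x => f x + g x).
Proof.
  revert f g; induction n as [|n IH]; intros f g.
  - intros [c Hc] [d Hd]; exists (c + d); intros x; now rewrite Hc, Hd.
  - intros [c [f' [Hf' Hf]]] [d [g' [Hg' Hg]]].
    exists (c + d), (fun x => f' x + g' x); split; [now apply IH|].
    intros x; rewrite Hf, Hg; ring.
Qed.

(** The scalar [k] is carried for the induction, since one Horner step turns it into [k * q]. *)
Lemma is_poly_dilate (n : nat) (f : R -> R) (k q : R) :
  is_poly n f -> is_poly n (fun x => k * f (q * x)).
Proof.
  revert f k; induction n as [|n IH]; intros f k.
  - intros [c Hc]; exists (k * c); intros x; now rewrite Hc.
  - intros [c [g [Hg Hf]]]; exists (k * c), (fun x => (k * q) * g (q * x)).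
    split; [now apply IH|].
    intros x; rewrite Hf; ring.
Qed.

Lemma is_poly_factor (n : nat) (f : R -> R) (z : R) :
  is_poly (S n) f -> exists g, is_poly n g /\ forall x, f x = f z + (x - z) * g x.
Proof.
  revert f; induction n as [|n IH]; intros f [c [g [Hg Hf]]].
  - destruct Hg as [d Hd]; exists (fun _ => d); split; [now exists d|].
    intros x; rewrite !Hf, !Hd; ring.
  - destruct (IH g Hg) as [h [Hh Hgh]].
    exists (fun x => g z + x * h x); split; [now exists (g z), h|].
    intros x; rewrite !Hf, (Hgh x); ring.
Qed.

(** Roots are encoded as [- / r i] so that every factor equals 1 at the origin; the leading constant
    is then [f 0], which is 1 for [P_N]. *)
Lemma is_poly_roots (n : nat) (f : R -> R) (r : nat -> R) :
  is_poly n f ->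
  (forall i, (i < n)%nat -> r i <> 0 /\ f (- / r i) = 0) ->
  (forall i j, (i < j < n)%nat -> r i <> r j) ->
  forall x, f x = f 0 * prod_first (fun i => 1 + r i * x) n.
Proof.
  revert f; induction n as [|n IH]; intros f Hf Hroot Hdist x.
  - destruct Hf as [c Hc]; simpl; rewrite !Hc; ring.
  - destruct (Hroot n ltac:(lia)) as [Hrn Hfn].
    destruct (is_poly_factor n f (- / r n) Hf) as [g [Hg Hfg]].
    assert (HgIH := IH g Hg).
    assert (Hgx : g x = g 0 * prod_first (fun i => 1 + r i * x) n).
    { apply HgIH; [|intros; apply Hdist; lia].
      intros i Hi; destruct (Hroot i ltac:(lia)) as [Hri Hfi]; split; [exact Hri|].
      rewrite Hfg, Hfn in Hfi.
      assert (Hne : - / r i - - / r n <> 0).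
      { assert (H := Hdist i n ltac:(lia)); intros H0; apply H.
        rewrite <- (Rinv_inv (r i)), <- (Rinv_inv (r n)); f_equal; lra. }
      destruct (Rmult_integral _ _ (eq_trans (eq_sym (Rplus_0_l _)) Hfi)); tauto. }
    simpl; rewrite (Hfg x), (Hfg 0), Hfn, Hgx; field; exact Hrn.
Qed.

(** This is the sum of [binomial(N,n) q^(n(n-1)/2) x^n], with ordinary binomials; the recursion is
    Pascal's rule. *)
Fixpoint dexp_poly (q : R) (N : nat) (x : R) : R :=
  match N with
  | O => 1
  | S M => dexp_poly q M x + x * dexp_poly q M (q * x)
  end.

Lemma dexp_poly_0 (q : R) (N : nat) : dexp_poly q N 0 = 1.
Proof. induction N as [|N IH]; simpl; [easy|]; rewrite IH; ring. Qed.

Lemma is_poly_dexp_poly (q : R) (N : nat) : is_poly N (dexp_poly q N).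
Proof.
  induction N as [|N IH]; [now exists 1|].
  apply (is_poly_plus (S N) (dexp_poly q N) (fun x => x * dexp_poly q N (q * x))).
  - now apply is_poly_S.
  - exists 0, (fun x => 1 * dexp_poly q N (q * x)); split.
    + now apply is_poly_dilate.
    + intros x; ring.
Qed.

(** Finite analogue of [f'(x) = f(qx)]. At [N = 0] the factor [INR 0] makes the value [pred 0 = 0]
    harmless. *)
Lemma is_derive_dexp_poly (q : R) (N : nat) (x : R) :
  is_derive (dexp_poly q N) x (INR N * dexp_poly q (pred N) (q * x)).
Proof.
  revert x; induction N as [|N IH]; intros x.
  - simpl; rewrite Rmult_0_l; apply (is_derive_const (K := R_AbsRing) (V := R_NormedModule)).
  - assert (Hq : is_derive (fun y => dexp_poly q N (q * y)) x
      (q * (INR N * dexp_poly q (pred N) (q * (q * x))))).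
    { apply (is_derive_comp (dexp_poly q N) (fun y => q * y)); [apply IH|].
      auto_derive; [easy|ring]. }
    assert (H : is_derive (dexp_poly q (S N)) x
      (INR N * dexp_poly q (pred N) (q * x) +
        (1 * dexp_poly q N (q * x) +
          x * (q * (INR N * dexp_poly q (pred N) (q * (q * x))))))).
    { apply (is_derive_plus (K := R_AbsRing) (V := R_NormedModule) (dexp_poly q N)); [apply IH|].
      apply (is_derive_mult (K := R_AbsRing) (fun y => y) (fun y => dexp_poly q N (q * y)) x);
        [apply (is_derive_id (K := R_AbsRing))|exact Hq|exact Rmult_comm]. }
    replace (INR (S N) * _) with (INR N * dexp_poly q (pred N) (q * x) +
        (1 * dexp_poly q N (q * x) +
          x * (q * (INR N * dexp_poly q (pred N) (q * (q * x)))))); [exact H|].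
    rewrite S_INR; destruct N as [|N]; simpl pred; [simpl; ring|].
    change (dexp_poly q (S N) (q * x)) with
      (dexp_poly q N (q * x) + q * x * dexp_poly q N (q * (q * x))); ring.
Qed.

Lemma continuity_dexp_poly (q : R) (N : nat) : continuity (dexp_poly q N).
Proof.
  intros x; apply derivable_continuous_pt.
  exists (INR N * dexp_poly q (pred N) (q * x)); apply is_derive_Reals, is_derive_dexp_poly.
Qed.

Lemma ratio_separated_lt (q : R) (r : nat -> R) (N : nat) :
  0 < q < 1 -> (forall i, (i < N)%nat -> 0 < r i) ->
  (forall i, (S i < N)%nat -> r (S i) < q * r i) ->
  forall i j, (i < j < N)%nat -> r j < q * r i.
Proof.
  intros Hq Hpos Hsep i j [Hij HjN]; induction Hij as [|j Hij IH].
  - now apply Hsep.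
  - assert (H1 := IH ltac:(lia)); assert (H2 := Hsep j HjN).
    assert (H3 := Hpos j ltac:(lia)); nra.
Qed.

Lemma IVT_strict (f : R -> R) (a b : R) :
  continuity f -> a < b -> f a * f b < 0 -> exists y, a < y < b /\ f y = 0.
Proof.
  intros Hf Hab H.
  destruct (IVT_cor f a b Hf (Rlt_le _ _ Hab) (Rlt_le _ _ H)) as [y [Hy Hy0]].
  exists y; split; [|exact Hy0].
  destruct (Req_dec y a) as [->|Ha]; [rewrite Hy0 in H; lra|].
  destruct (Req_dec y b) as [->|Hb]; [rewrite Hy0 in H; lra|lra].
Qed.

(** Far out on the negative axis, dilation by [q] shrinks the product by a bounded factor only.
    Hence in [P_{N+1}(-y) = P_N(-y) - y P_N(-qy)] the second term wins and fixes the sign. *)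
Lemma prod_first_dilate_ge (q : R) (r : nat -> R) (n : nat) :
  0 < q < 1 -> (forall i, (i < n)%nat -> 0 < r i) ->
  exists Y, forall y, Y <= y ->
    0 < (-1) ^ n * prod_first (fun i => 1 + r i * - y) n /\
    (q / 2) ^ n * ((-1) ^ n * prod_first (fun i => 1 + r i * - y) n)
      <= (-1) ^ n * prod_first (fun i => 1 + r i * (q * - y)) n.
Proof.
  intros Hq; induction n as [|n IH]; intros Hr.
  - exists 0; intros y _; simpl; lra.
  - destruct IH as [Y HY]; [auto with arith|].
    assert (Hrn := Hr n ltac:(lia)).
    (* Beyond [2 / (q r_n)] one has [q r_n y >= 2], hence [q r_n y - 1 >= (q/2) (r_n y - 1)]: each
       factor costs at most [q/2]. *)
    exists (Rmax Y (2 / (q * r n))); intros y Hy.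
    assert (Hy1 := Rle_trans _ _ _ (Rmax_l _ _) Hy).
    assert (Hy2 := Rle_trans _ _ _ (Rmax_r _ _) Hy).
    assert (Hqr : 0 < q * r n) by nra.
    assert (Hy3 : 2 <= q * r n * y).
    { apply Rmult_le_compat_l with (r := q * r n) in Hy2; [|lra].
      replace (q * r n * (2 / (q * r n))) with 2 in Hy2 by (field; lra); lra. }
    destruct (HY y Hy1) as [HA HB]; simpl.
    set (A := prod_first (fun i => 1 + r i * - y) n) in *.
    set (B := prod_first (fun i => 1 + r i * (q * - y)) n) in *.
    assert (Hy4 : 2 < r n * y) by (assert (0 < r n * y) by nra; nra).
    assert (Hpow := pow_lt (q / 2) n ltac:(lra)).
    split.
    + replace (-1 * (-1) ^ n * (A * (1 + r n * - y)))
        with ((-1) ^ n * A * (r n * y - 1)) by ring.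
      apply Rmult_lt_0_compat; lra.
    + replace (q / 2 * (q / 2) ^ n * (-1 * (-1) ^ n * (A * (1 + r n * - y))))
        with ((q / 2) ^ n * ((-1) ^ n * A) * (q / 2 * (r n * y - 1))) by ring.
      replace (-1 * (-1) ^ n * (B * (1 + r n * (q * - y))))
        with ((-1) ^ n * B * (q * r n * y - 1)) by ring.
      apply Rmult_le_compat; [| |exact HB|lra].
      * apply Rmult_le_pos; lra.
      * apply Rmult_le_pos; lra.
Qed.

Lemma pow_m1_sqr (n : nat) : (-1) ^ n * (-1) ^ n = 1.
Proof. rewrite <- Rpow_mult_distr; replace (-1 * -1) with 1 by ring; apply pow1. Qed.

(* The zeros [-y] of [P_{N+1}] are trapped by sign changes
   between the zeros of [P_N(qx)] and those of [P_N(x)]. *)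
Lemma dexp_poly_step_root (q : R) (r : nat -> R) (N i : nat) :
  0 < q < 1 -> (forall i, (i < N)%nat -> 0 < r i) ->
  (forall i, (S i < N)%nat -> r (S i) < q * r i) ->
  (forall x, dexp_poly q N x = prod_first (fun i => 1 + r i * x) N) ->
  (i <= N)%nat ->
  exists y, 0 < y /\ (forall j, i = S j -> 1 < y * (q * r j)) /\
    ((i < N)%nat -> y * r i < 1) /\ dexp_poly q (S N) (- y) = 0.
Proof.
  intros Hq Hpos Hsep HP Hi.
  assert (Hlt := ratio_separated_lt q r N Hq Hpos Hsep).
  set (D := fun y => dexp_poly q (S N) (- y)).
  assert (HD : forall y, D y = prod_first (fun i => 1 + r i * - y) N
    - y * prod_first (fun i => 1 + r i * (q * - y)) N).
  { intros y; unfold D; simpl; rewrite !HP; ring. }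
  assert (HDc : continuity D).
  { apply (continuity_comp Ropp (dexp_poly q (S N))).
    - apply continuity_opp, derivable_continuous, derivable_id.
    - apply continuity_dexp_poly. }
  (* Left end: at [a = 1/(q r_{i-1})] the dilated product vanishes and [D a = P_N(-a)], whose
     factors with index below [i] are exactly the negative ones. For [i = 0] the origin is used,
     where [D] is 1. *)
  assert (Hlo : exists a, 0 <= a /\ (i = 0%nat -> a = 0) /\
    (forall j, i = S j -> a * (q * r j) = 1) /\
    0 < (-1) ^ i * D a).
  { destruct i as [|j].
    - exists 0; split; [lra|]; split; [easy|]; split; [easy|].
      unfold D; rewrite Ropp_0, dexp_poly_0; simpl; lra.
    - assert (Hrj := Hpos j Hi).
      assert (Hqr : 0 < q * r j) by nra.
      assert (Ha := Rinv_0_lt_compat _ Hqr).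
      assert (Ha1 : / (q * r j) * (q * r j) = 1) by (field; lra).
      exists (/ (q * r j)); split; [lra|]; split; [easy|]; split.
      + intros j' [= <-]; exact Ha1.
      + set (a := / (q * r j)) in *; rewrite HD.
        rewrite (prod_first_eq_0 (fun i => 1 + r i * (q * - a)) j) by (lia || lra).
        rewrite Rmult_0_r, Rminus_0_r; apply prod_first_sign; [exact Hi| |].
        * intros m Hm.
          assert (Hmj : r j <= r m).
          { destruct (Nat.eq_dec m j) as [->|Hne]; [lra|].
            assert (H := Hlt m j ltac:(lia)); assert (H' := Hpos m ltac:(lia)); nra. }
          assert (a * r j <= a * r m) by (apply Rmult_le_compat_l; lra).
          assert (0 < a * r j) by nra; nra.
        * intros m Hm; assert (H := Hlt j m ltac:(lia)).
          assert (a * r m < a * (q * r j)) by (apply Rmult_lt_compat_l; lra); lra. }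
  destruct Hlo as [a [Ha0 [Ha00 [Ha1 Ha]]]].
  (* Right end: at [b = 1/r_i] only [- b P_N(-qb)] survives, again with [i] negative factors, and
     the minus sign supplies the extra [-1]. Separation gives [a < b]. *)
  assert (Hhi : exists b, a < b /\ ((i < N)%nat -> b * r i = 1) /\
    0 < (-1) ^ S i * D b).
  { destruct (Nat.eq_dec i N) as [->|Hne].
    (* For the new outermost zero there is no [r_N]; any [b] past [Y] and [(2/q)^N] makes the
       dilated term dominate. *)
    - destruct (prod_first_dilate_ge q r N Hq Hpos) as [Y HY].
      assert (Hpow := pow_lt (q / 2) N ltac:(lra)).
      set (w := / (q / 2) ^ N).
      assert (Hw : 0 < w) by now apply Rinv_0_lt_compat.
      set (b := Rmax Y (a + w) + 1).
      assert (Hb1 := Rmax_l Y (a + w)); assert (Hb2 := Rmax_r Y (a + w)).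
      exists b; split; [unfold b; lra|]; split; [lia|].
      destruct (HY b) as [HA HB]; [unfold b; lra|]; rewrite HD; simpl.
      set (A := prod_first (fun i => 1 + r i * - b) N) in *.
      set (B := prod_first (fun i => 1 + r i * (q * - b)) N) in *.
      replace (-1 * (-1) ^ N * (A - b * B))
        with (b * ((-1) ^ N * B) - (-1) ^ N * A) by ring.
      assert (Hwb : w < b) by (unfold b; lra).
      assert (H1 : 1 < b * (q / 2) ^ N).
      { apply Rmult_lt_compat_r with (r := (q / 2) ^ N) in Hwb; [|lra].
        unfold w in Hwb; rewrite Rinv_l in Hwb; lra. }
      assert (H2 : b * ((q / 2) ^ N * ((-1) ^ N * A)) <= b * ((-1) ^ N * B))
        by (apply Rmult_le_compat_l; lra).
      assert (H3 : 1 * ((-1) ^ N * A) < b * (q / 2) ^ N * ((-1) ^ N * A))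
        by (apply Rmult_lt_compat_r; lra).
      lra.
    - assert (HiN : (i < N)%nat) by lia.
      assert (Hri := Hpos i HiN); assert (Hb := Rinv_0_lt_compat _ Hri).
      assert (Hb1 : / r i * r i = 1) by (field; lra).
      exists (/ r i); set (b := / r i) in *.
      split; [|split; [intros _; exact Hb1|]].
      + destruct i as [|j].
        * rewrite Ha00 by easy; exact Hb.
        * assert (H := Ha1 j eq_refl); assert (H' := Hsep j HiN).
          apply Rmult_lt_reg_r with (r (S j)); [exact Hri|]; rewrite Hb1.
          assert (0 < a) by (assert (H2 := Hpos j ltac:(lia)); nra); nra.
      + rewrite HD.
        rewrite (prod_first_eq_0 (fun i => 1 + r i * - b) i) by (lia || lra).
        replace ((-1) ^ S i * (0 - b * _)) with
          (b * ((-1) ^ i * prod_first (fun i => 1 + r i * (q * - b)) N)) by (simpl; ring).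
        apply Rmult_lt_0_compat; [exact Hb|]; apply prod_first_sign; [lia| |].
        * intros m Hm; assert (H := Hlt m i ltac:(lia)).
          assert (b * r i < b * (q * r m)) by (apply Rmult_lt_compat_l; lra); lra.
        * intros m Hm.
          assert (Hmi : r m <= r i).
          { destruct (Nat.eq_dec m i) as [->|Hne']; [lra|].
            assert (H := Hlt i m ltac:(lia)); nra. }
          assert (b * r m <= b * r i) by (apply Rmult_le_compat_l; lra).
          nra. }
  destruct Hhi as [b [Hab [Hb1 Hb]]].
  destruct (IVT_strict D a b HDc Hab) as [y [Hy Hy0]].
  { assert (H := Rmult_lt_0_compat _ _ Ha Hb).
    assert (Hs := pow_m1_sqr i); simpl in H.
    replace ((-1) ^ i * D a * (-1 * (-1) ^ i * D b))
      with (- ((-1) ^ i * (-1) ^ i) * (D a * D b)) in H by ring.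
    rewrite Hs in H; lra. }
  exists y; split; [lra|]; split; [|split; [|exact Hy0]].
  - intros j Hj; rewrite <- (Ha1 j Hj).
    apply Rmult_lt_compat_r; [|lra].
    assert (H := Hpos j ltac:(lia)); nra.
  - intros HiN; rewrite <- (Hb1 HiN); apply Rmult_lt_compat_r; [now apply Hpos|lra].
Qed.

(** Separation reproduces itself: the trapped zeros satisfy [Y i * r i < 1 < Y (S i) * (q * r i)],
    whence [Y i < q * Y (S i)]. The [N + 1] zeros so found are distinct and exhaust the degree. *)
Lemma dexp_poly_real_rooted (q : R) (N : nat) :
  0 < q < 1 ->
  exists r : nat -> R,
    (forall i, (i < N)%nat -> 0 < r i) /\
    (forall i, (S i < N)%nat -> r (S i) < q * r i) /\
    (forall x, dexp_poly q N x = prod_first (fun i => 1 + r i * x) N).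
Proof.
  intros Hq; induction N as [|N [r [Hpos [Hsep HP]]]].
  - exists (fun _ => 1); repeat split; lia.
  - destruct (functional_choice (fun i y => (i <= N)%nat ->
      0 < y /\ (forall j, i = S j -> 1 < y * (q * r j)) /\
      ((i < N)%nat -> y * r i < 1) /\ dexp_poly q (S N) (- y) = 0)) as [Y HY].
    { intros i; destruct (Nat.le_gt_cases i N) as [Hi|Hi]; [|exists 0; lia].
      destruct (dexp_poly_step_root q r N i Hq Hpos Hsep HP Hi) as [y Hy].
      now exists y. }
    assert (Hposr : forall i, (i < S N)%nat -> 0 < / Y i).
    { intros i Hi; apply Rinv_0_lt_compat; apply HY; lia. }
    assert (Hsepr : forall i, (S i < S N)%nat -> / Y (S i) < q * / Y i).
    { intros i Hi.
      destruct (HY i ltac:(lia)) as [Hi0 [_ [Hi1 _]]].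
      destruct (HY (S i) ltac:(lia)) as [Hs0 [Hs1 _]].
      specialize (Hi1 ltac:(lia)); specialize (Hs1 i eq_refl).
      assert (Hr := Hpos i ltac:(lia)).
      assert (HYY : Y i < q * Y (S i)).
      { apply Rmult_lt_reg_r with (r i); [exact Hr|]; lra. }
      apply Rmult_lt_reg_r with (Y i); [exact Hi0|].
      rewrite Rmult_assoc, Rinv_l, Rmult_1_r by lra.
      apply Rmult_lt_reg_l with (Y (S i)); [exact Hs0|].
      rewrite <- Rmult_assoc, Rinv_r, Rmult_1_l by lra; lra. }
    exists (fun i => / Y i); split; [exact Hposr|]; split; [exact Hsepr|].
    intros x.
    rewrite (is_poly_roots (S N) (dexp_poly q (S N)) (fun i => / Y i)).
    + rewrite dexp_poly_0; ring.
    + apply is_poly_dexp_poly.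
    + intros i Hi; split; [apply Rgt_not_eq, Hposr, Hi|].
      rewrite Rinv_inv; apply HY; lia.
    + intros i j Hij.
      assert (H := ratio_separated_lt q (fun i => / Y i) (S N) Hq Hposr Hsepr i j Hij).
      assert (H' := Hposr i ltac:(lia)); simpl in H; nra.
Qed.

(** The product has [S n] factors because [sum_f_R0 _ n] has [n + 1] terms. *)
Lemma is_derive_prod_first (r : nat -> R) (n : nat) (x : R) :
  (forall i, 1 + r i * x <> 0) ->
  is_derive (fun y => prod_first (fun i => 1 + r i * y) (S n)) x
    (prod_first (fun i => 1 + r i * x) (S n)
      * sum_f_R0 (fun i => r i / (1 + r i * x)) n).
Proof.
  intros Hx.
  assert (Hlin : forall i, is_derive (fun y => 1 + r i * y) x (r i)).
  { intros i; auto_derive; [easy|ring]. }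
  induction n as [|n IH].
  - apply (is_derive_ext (fun y => 1 + r 0%nat * y)); [intros t; simpl; ring|].
    replace (prod_first _ 1 * _) with (r 0%nat); [apply Hlin|].
    simpl; field; apply Hx.
  - assert (H := is_derive_mult (K := R_AbsRing) _ _ x _ _ IH (Hlin (S n)) Rmult_comm).
    set (m := S n) in *.
    change (prod_first (fun i => 1 + r i * x) (S m)) with
      (prod_first (fun i => 1 + r i * x) m * (1 + r m * x)).
    apply (is_derive_ext (fun y => prod_first (fun i => 1 + r i * y) m * (1 + r m * y)));
      [easy|].
    replace (prod_first (fun i => 1 + r i * x) m * (1 + r m * x) *
      sum_f_R0 (fun i => r i / (1 + r i * x)) m) with
      (prod_first (fun i => 1 + r i * x) m * sum_f_R0 (fun i => r i / (1 + r i * x)) n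
        * (1 + r m * x) + prod_first (fun i => 1 + r i * x) m * r m); [exact H|].
    change (sum_f_R0 (fun i => r i / (1 + r i * x)) m) with
      (sum_f_R0 (fun i => r i / (1 + r i * x)) n + r m / (1 + r m * x)).
    field; apply Hx.
Qed.

(** The rescaling cancels the factor [N] of [P_N']. The degree drops to [M] while the scale stays
    [S M], so this derivative needs its own limit statement. *)
Lemma is_derive_dexp_approx (q y : R) (M : nat) :
  is_derive (fun y => dexp_poly q (S M) (y / INR (S M))) y
    (dexp_poly q M (q * y / INR (S M))).
Proof.
  assert (HN : INR (S M) <> 0) by (apply not_0_INR; lia).
  replace (dexp_poly q M (q * y / INR (S M))) with
    (/ INR (S M) * (INR (S M) * dexp_poly q M (q * (y / INR (S M))))).
  - apply (is_derive_comp (dexp_poly q (S M)) (fun y => y / INR (S M))).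
    + apply (is_derive_dexp_poly q (S M)).
    + generalize dependent (INR (S M)); intros K HK; auto_derive; [easy|now field].
  - replace (q * (y / INR (S M))) with (q * y / INR (S M)) by (field; exact HN).
    field; exact HN.
Qed.

(** Inverse roots of the rescaled polynomial of degree [S M], padded with zeros: the padding
    contributes factors 1 and summands 0, so every degree is treated as one infinite sequence. The
    ratio bound and [r 0 <= 1] give the majorant [q ^ i], uniform in [M]. *)
Definition approx_roots (q : R) (M : nat) (r : nat -> R) : Prop :=
  (forall i, (i <= M)%nat -> 0 < r i) /\
  (forall i, (M < i)%nat -> r i = 0) /\
  (forall i, r (S i) <= q * r i) /\
  r 0%nat <= 1 /\
  (forall y, dexp_poly q (S M) (y / INR (S M))
    = prod_first (fun i => 1 + r i * y) (S M)).

Lemma approx_roots_exists (q : R) (M : nat) :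
  0 < q < 1 -> exists r, approx_roots q M r.
Proof.
  intros Hq.
  destruct (dexp_poly_real_rooted q (S M) Hq) as [r [Hpos [Hsep HP]]].
  assert (HN : 0 < INR (S M)) by (apply lt_0_INR; lia).
  assert (HNi := Rinv_0_lt_compat _ HN).
  set (s := fun i => if (i <=? M)%nat then r i / INR (S M) else 0).
  assert (Hs1 : forall i, (i <= M)%nat -> s i = r i / INR (S M)).
  { intros i Hi; unfold s; now rewrite (proj2 (Nat.leb_le i M) Hi). }
  assert (Hs2 : forall i, (M < i)%nat -> s i = 0).
  { intros i Hi; unfold s; now rewrite (proj2 (Nat.leb_gt i M) Hi). }
  assert (Hs3 : forall i, (i <= M)%nat -> 0 < s i).
  { intros i Hi; rewrite Hs1 by exact Hi; apply Rdiv_lt_0_compat; [apply Hpos; lia|lra]. }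
  assert (HsP : forall y, dexp_poly q (S M) (y / INR (S M))
    = prod_first (fun i => 1 + s i * y) (S M)).
  { intros y; rewrite HP; apply prod_first_ext; intros i Hi.
    rewrite Hs1 by lia; field; lra. }
  exists s; split; [exact Hs3|]; split; [exact Hs2|]; split; [|split; [|exact HsP]].
  - intros i; destruct (Nat.lt_ge_cases i M) as [Hi|Hi].
    + rewrite !Hs1 by lia; specialize (Hsep i ltac:(lia)); unfold Rdiv.
      rewrite <- Rmult_assoc; apply Rmult_le_compat_r; lra.
    + rewrite (Hs2 (S i)) by lia; destruct (Nat.eq_dec i M) as [->|Hne].
      * specialize (Hs3 M ltac:(lia)); nra.
      * rewrite (Hs2 i) by lia; lra.
  - (* comparing derivatives at 0, the [s i] sum to 1 *)
    assert (H1 : sum_f_R0 (fun i => s i / (1 + s i * 0)) M = 1).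
    { assert (H1 : dexp_poly q M (q * 0 / INR (S M)) = dexp_poly q (S M) (0 / INR (S M))
        * sum_f_R0 (fun i => s i / (1 + s i * 0)) M).
      { rewrite HsP, <- (is_derive_unique _ _ _
          (is_derive_prod_first s M 0 ltac:(intros; rewrite Rmult_0_r; lra))).
        rewrite <- (is_derive_unique _ _ _ (is_derive_dexp_approx q 0 M)).
        apply Derive_ext, HsP. }
      replace (q * 0 / INR (S M)) with 0 in H1 by (field; lra).
      replace (0 / INR (S M)) with 0 in H1 by (field; lra).
      rewrite !dexp_poly_0 in H1; lra. }
    rewrite (sum_eq _ s) in H1 by (intros; field).
    rewrite <- H1; clear - Hs3.
    assert (H : forall m, (m <= M)%nat -> s 0%nat <= sum_f_R0 s m).
    { induction m as [|m IH]; intros Hm; simpl; [lra|].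
      specialize (Hs3 (S m) Hm); specialize (IH ltac:(lia)); lra. }
    now apply H.
Qed.

Lemma approx_roots_nonneg (q : R) (M : nat) (r : nat -> R) (i : nat) :
  approx_roots q M r -> 0 <= r i.
Proof.
  intros [Hpos [H0 _]]; destruct (Nat.le_gt_cases i M) as [Hi|Hi].
  - left; now apply Hpos.
  - rewrite H0 by exact Hi; lra.
Qed.

Lemma approx_roots_le_pow (q : R) (M : nat) (r : nat -> R) (i : nat) :
  0 < q < 1 -> approx_roots q M r -> r i <= q ^ i.
Proof.
  intros Hq [_ [_ [Hsep [H1 _]]]]; induction i as [|i IH]; simpl; [exact H1|].
  specialize (Hsep i); nra.
Qed.

Lemma approx_roots_mono (q : R) (M : nat) (r : nat -> R) (i j : nat) :
  0 < q < 1 -> approx_roots q M r -> (i <= j)%nat -> r j <= r i.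
Proof.
  intros Hq Hr Hij; induction Hij as [|j _ IH]; [lra|].
  assert (H := approx_roots_nonneg q M r j Hr).
  destruct Hr as [_ [_ [Hsep _]]]; specialize (Hsep j); nra.
Qed.

(** * Convergence of the rescaled polynomials to [f] *)

Fixpoint falling (X : R) (n : nat) : R :=
  match n with
  | O => 1
  | S m => falling X m * (X - INR m)
  end.

Lemma falling_succ (X : R) (n : nat) : falling (X + 1) (S n) = (X + 1) * falling X n.
Proof.
  induction n as [|n IH]; [simpl; ring|].
  change (falling (X + 1) (S n) * (X + 1 - INR (S n)) = (X + 1) * (falling X n * (X - INR n))).
  rewrite IH, S_INR; ring.
Qed.

Lemma falling_INR_0 (N n : nat) : (N < n)%nat -> falling (INR N) n = 0.
Proof.
  intros H; induction H as [|n _ IH]; simpl.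
  - ring.
  - rewrite IH; ring.
Qed.

Lemma falling_bounds (N n : nat) : 0 <= falling (INR N) n <= INR N ^ n.
Proof.
  induction n as [|n IH]; [simpl; lra|].
  destruct (Nat.le_gt_cases n N) as [Hn|Hn].
  - simpl; apply le_INR in Hn; assert (H := pos_INR n).
    assert (Hp := pow_le (INR N) n (pos_INR N)); split; [nra|].
    rewrite Rmult_comm; apply Rmult_le_compat; lra.
  - rewrite falling_INR_0 by lia; split; [lra|]; apply pow_le, pos_INR.
Qed.

Lemma is_series_R_ext (a b : nat -> R) (l : R) :
  (forall n, a n = b n) -> is_series a l -> is_series b l.
Proof. apply is_series_ext. Qed.

Lemma is_series_R_cons (a : nat -> R) (l : R) :
  is_series a l <-> is_series (fun n => a (S n)) (l - a 0%nat).
Proof.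
  split; intros H.
  - apply is_series_incr_1.
    change (is_series a (l - a 0%nat + a 0%nat)).
    now replace (l - a 0%nat + a 0%nat) with l by ring.
  - now apply is_series_decr_1.
Qed.

(** Since [falling (INR N) n] vanishes for [n > N], the polynomial is a power series and the uniform
    limit lemma for power series applies. The induction step combines [dexp_coef_S] with
    [(N - n) + (n + 1) = N + 1]. *)
Lemma is_series_dexp_poly (q : R) (N : nat) (x : R) :
  is_series (fun n => falling (INR N) n * dexp_coef q n * x ^ n) (dexp_poly q N x).
Proof.
  revert x; induction N as [|N IH]; intros x; apply is_series_R_cons.
  - apply is_series_R_ext with (fun _ : nat => 0).
    + intros n; rewrite falling_INR_0 by lia; ring.
    + rewrite dexp_coef_0; simpl falling; simpl dexp_poly.
      replace (1 - 1 * 1 * x ^ 0) with 0 by (simpl; ring).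
      apply is_series_Reals; intros eps He; exists 0%nat; intros n _.
      rewrite sum_eq_R0 by easy; now rewrite Rdist_eq.
  - assert (H1 := proj1 (is_series_R_cons _ _) (IH x)).
    cbv beta in H1; rewrite dexp_coef_0 in H1.
    assert (H2 := is_series_scal (V := R_NormedModule) x _ _ (IH (q * x))).
    assert (H := is_series_plus (V := R_NormedModule) _ _ _ _ H1 H2).
    rewrite dexp_coef_0; simpl falling at 2.
    replace (dexp_poly q (S N) x - 1 * 1 * x ^ 0) with
      (dexp_poly q N x - 1 * 1 * x ^ 0 + x * dexp_poly q N (q * x)) by (simpl; ring).
    revert H; apply is_series_R_ext; intros n.
    change (falling (INR N) (S n) * dexp_coef q (S n) * x ^ S n
      + x * (falling (INR N) n * dexp_coef q n * (q * x) ^ n)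
      = falling (INR (S N)) (S n) * dexp_coef q (S n) * x ^ S n).
    simpl (falling (INR N) (S n)); rewrite (S_INR N), falling_succ, Rpow_mult_distr.
    assert (Hc := dexp_coef_S q n); rewrite S_INR in Hc; simpl pow.
    replace (x * (falling (INR N) n * dexp_coef q n * (q ^ n * x ^ n))) with
      (x * x ^ n * falling (INR N) n * (q ^ n * dexp_coef q n)) by ring.
    rewrite <- Hc; ring.
Qed.

Lemma filterlim_falling (k : nat -> nat) (n : nat) :
  filterlim (fun M => INR (k M) / INR (S M)) eventually (locally 1) ->
  filterlim (fun M => falling (INR (k M)) n / INR (S M) ^ n) eventually (locally 1).
Proof.
  intros Hk; induction n as [|n IH]; simpl falling.
  - apply filterlim_ext with (fun _ => 1); [intros M; simpl; field|].
    apply (filterlim_const (U := R_UniformSpace)).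
  - apply filterlim_ext with (fun M => falling (INR (k M)) n / INR (S M) ^ n *
      (INR (k M) / INR (S M) + - (INR n * / INR (S M)))).
    { intros M; assert (H : INR (S M) <> 0) by (apply not_0_INR; lia).
      change (INR (S M) ^ S n) with (INR (S M) * INR (S M) ^ n).
      field; split; [now apply pow_nonzero|exact H]. }
    replace (locally 1) with (locally (1 * (1 + - (INR n * 0)))) by (f_equal; ring).
    apply (filterlim_R_mult nat eventually); [exact IH|].
    apply (filterlim_R_plus nat eventually); [exact Hk|].
    apply filterlim_R_opp.
    apply (filterlim_R_mult nat eventually);
      [apply (filterlim_const (U := R_UniformSpace))|].
    apply (is_lim_seq_incr_1 (fun M => / INR M) 0).
    apply (is_lim_seq_inv INR p_infty); [apply is_lim_seq_INR|easy].
Qed.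

(** The degree [k M] is left free because the approximants have degree [S M] and their derivatives
    degree [M], both at scale [S M]. *)
Lemma dexp_poly_unif_limit (q : R) (k : nat -> nat) :
  0 < q < 1 -> (forall M, (k M <= S M)%nat) ->
  filterlim (fun M => INR (k M) / INR (S M)) eventually (locally 1) ->
  converges_unif_on_compacts eventually
    (fun M y => dexp_poly q (k M) (y / INR (S M))) (fun y => dexp y q).
Proof.
  intros Hq Hk Hlim A eps He.
  set (a := fun M n => falling (INR (k M)) n / INR (S M) ^ n * dexp_coef q n).
  assert (HK : forall M, 0 < INR (S M)) by (intros M; apply lt_0_INR; lia).
  assert (Heq : forall M y, dexp_poly q (k M) (y / INR (S M)) = PSeries (a M) y).
  { intros M y; symmetry; apply is_series_unique.
    apply is_series_R_ext with
      (fun n => falling (INR (k M)) n * dexp_coef q n * (y / INR (S M)) ^ n).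
    - intros n; unfold a, Rdiv; rewrite Rpow_mult_distr, pow_inv; ring.
    - apply is_series_dexp_poly. }
  eapply filter_imp;
    [|apply (pseries_filterlim_unif nat eventually a (dexp_coef q) A eps He)].
  - intros M HM y Hy; simpl in HM; rewrite Heq; now apply HM.
  - apply filter_forall; intros M n; unfold a.
    assert (Hb := falling_bounds (k M) n); assert (Hp := pow_lt _ n (HK M)).
    assert (Hkp : INR (k M) ^ n <= INR (S M) ^ n).
    { apply pow_incr; split; [apply pos_INR|apply le_INR, Hk]. }
    assert (Hf : 0 <= falling (INR (k M)) n / INR (S M) ^ n <= 1).
    { assert (Hpi := Rinv_0_lt_compat _ Hp); unfold Rdiv; split; [nra|].
      apply Rmult_le_reg_r with (INR (S M) ^ n); [exact Hp|].
      rewrite Rmult_assoc, Rinv_l by lra; lra. }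
    rewrite Rabs_mult, (Rabs_right (_ / _)) by lra.
    assert (Hd := dexp_coef_Rabs_le q n Hq); assert (Hd0 := Rabs_pos (dexp_coef q n)); nra.
  - intros n; now apply dexp_coef_Rabs_le.
  - intros n; unfold a.
    replace (locally (dexp_coef q n)) with (locally (1 * dexp_coef q n)) by (f_equal; ring).
    apply (filterlim_R_mult nat eventually);
      [now apply filterlim_falling|apply (filterlim_const (U := R_UniformSpace))].
Qed.

Lemma dexp_approx_unif_limit (q : R) :
  0 < q < 1 ->
  converges_unif_on_compacts eventually
    (fun M y => dexp_poly q (S M) (y / INR (S M))) (fun y => dexp y q).
Proof.
  intros Hq; apply (dexp_poly_unif_limit q S Hq); [easy|].
  apply filterlim_ext with (fun _ => 1);
    [|apply (filterlim_const (U := R_UniformSpace))].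
  intros M; field; apply not_0_INR; lia.
Qed.

Lemma dexp_approx_derive_unif_limit (q : R) :
  0 < q < 1 ->
  converges_unif_on_compacts eventually
    (fun M y => dexp_poly q M (y / INR (S M))) (fun y => dexp y q).
Proof.
  intros Hq; apply (dexp_poly_unif_limit q (fun M => M) Hq); [auto with arith|].
  apply filterlim_ext with (fun M => 1 + - / INR (S M)).
  - intros M; rewrite S_INR; field.
    assert (H := pos_INR M); lra.
  - replace (locally 1) with (locally (1 + - 0)) by (f_equal; ring).
    apply (filterlim_R_plus nat eventually); [apply (filterlim_const (U := R_UniformSpace))|].
    apply filterlim_R_opp.
    apply (is_lim_seq_incr_1 (fun M => / INR M) 0).
    apply (is_lim_seq_inv INR p_infty); [apply is_lim_seq_INR|easy].
Qed.

(** * Product formula and logarithmic derivative *)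

Lemma unif_limit_comp (T : Type) (F : (T -> Prop) -> Prop) {FF : Filter F}
  (g : T -> R -> R) (f : R -> R) (u : T -> R) (y : R) :
  converges_unif_on_compacts F g f -> continuous f y ->
  filterlim u F (locally y) ->
  filterlim (fun t => g t (u t)) F (locally (f y)).
Proof.
  intros Hg Hf Hu; apply (filterlim_R_eps T F); intros eps He.
  assert (H1 := proj1 (filterlim_R_eps T F _ _) (filterlim_R_comp T F u f y Hf Hu)
    (eps / 2) ltac:(lra)).
  assert (H2 := filterlim_R_lt T F _ (Rabs y) (Rabs y + 1) ltac:(lra) (filterlim_R_abs T F u y Hu)).
  assert (H3 := Hg (Rabs y + 1) (eps / 2) ltac:(lra)).
  generalize (filter_and _ _ H1 (filter_and _ _ H2 H3)); apply filter_imp.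
  intros t [Ht1 [Ht2 Ht3]]; specialize (Ht3 (u t) (Rlt_le _ _ Ht2)).
  apply Rabs_def2 in Ht1; apply Rabs_def2 in Ht3; apply Rabs_def1; lra.
Qed.

Lemma eventually_ge (n : nat) : eventually (fun M => (n <= M)%nat).
Proof. now exists n. Qed.

(** The zeros [- / rho M i] are separated with ratio [q] for every [M], so stability of zeros
    applies with [s = q]. Index [i] denotes an actual zero once [i <= M], hence eventually. *)
Lemma approx_roots_limit (q : R) (x : nat -> R) (rho : nat -> nat -> R) (k : nat) :
  0 < q < 1 -> enumerates_zeros (fun y => dexp y q) x ->
  (forall M, approx_roots q M (rho M)) ->
  filterlim (fun M => rho M k) eventually (locally (- / x k)).
Proof.
  intros Hq Hx Hrho.
  assert (Hpos : forall i M, (i <= M)%nat -> 0 < rho M i) by (intros i M; apply (Hrho M)).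
  assert (Hprod : forall M y, dexp_poly q (S M) (y / INR (S M)) = 0 ->
    exists i, (i <= M)%nat /\ y = - / rho M i).
  { intros M y Hy; destruct (Hrho M) as [_ [_ [_ [_ HP]]]]; rewrite HP in Hy.
    apply prod_first_0_inv in Hy; destruct Hy as [i [Hi Hi0]].
    exists i; split; [lia|]; assert (H := Hpos i M ltac:(lia)).
    apply Rmult_eq_reg_l with (rho M i); [|lra].
    rewrite Ropp_mult_distr_r_reverse, Rinv_r; lra. }
  assert (Hmono : forall M i j, (i <= j <= M)%nat -> - / rho M j <= - / rho M i).
  { intros M i j Hij; apply Ropp_le_contravar, Rinv_le_contravar; [apply Hpos; lia|].
    apply (approx_roots_mono q M); [exact Hq|apply Hrho|lia]. }
  assert (Hz : filterlim (fun M => - / rho M k) eventually (locally (x k))).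
  { apply (separated_zeros_filterlim nat eventually
      (fun M y => dexp_poly q (S M) (y / INR (S M))) (fun y => dexp y q)
      (fun y => dexp (q * y) q) (fun i M => - / rho M i) x q).
    - now apply dexp_approx_unif_limit.
    - apply filter_forall; intros M y.
      apply derivable_continuous_pt; eexists.
      apply is_derive_Reals, is_derive_dexp_approx.
    - intros y; now apply is_derive_dexp.
    - intros i; now apply zeros_simple.
    - exact Hx.
    - rewrite dexp_0; lra.
    - exact Hq.
    - apply filter_forall; intros M.
      assert (H := Rinv_0_lt_compat _ (Hpos 0%nat M ltac:(lia))); lra.
    - intros i; generalize (eventually_ge (S i)); apply filter_imp; intros M HM.
      assert (H1 := Hpos i M ltac:(lia)); assert (H2 := Hpos (S i) M HM).
      assert (H3 : rho M (S i) <= q * rho M i) by apply (Hrho M).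
      assert (H4 := Rinv_le_contravar _ _ H2 H3).
      rewrite Rinv_mult in H4; unfold Rdiv; lra.
    - intros i; generalize (eventually_ge i); apply filter_imp; intros M HM.
      assert (H1 := Hpos i M HM); destruct (Hrho M) as [_ [_ [_ [_ HP]]]]; rewrite HP.
      apply (prod_first_eq_0 _ i); [lia|]; field; lra.
    - apply filter_forall; intros M y Hy.
      destruct (Hprod M y Hy) as [i [Hi ->]]; apply Hmono; lia.
    - intros i; generalize (eventually_ge (S i)); apply filter_imp; intros M HM y Hy.
      destruct (Hprod M y Hy) as [j [Hj ->]].
      destruct (Nat.le_gt_cases j i); [right|left]; apply Hmono; lia. }
  assert (Hxk := enumerates_zeros_neg _ _ k Hx).
  apply filterlim_R_inv in Hz; [|lra]; apply filterlim_R_opp in Hz.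
  revert Hz; apply filterlim_ext_loc; generalize (eventually_ge k); apply filter_imp.
  intros M HM; assert (H := Hpos k M HM); field; lra.
Qed.

Lemma approx_roots_factor_neq_0 (q y : R) (M : nat) (r : nat -> R) (i : nat) :
  approx_roots q M r -> dexp_poly q (S M) (y / INR (S M)) <> 0 -> 1 + r i * y <> 0.
Proof.
  intros [_ [H0 [_ [_ HP]]]] Hy Hi; destruct (Nat.le_gt_cases i M) as [HiM|HiM].
  - apply Hy; rewrite HP; apply (prod_first_eq_0 _ i); [lia|exact Hi].
  - rewrite H0 in Hi by exact HiM; lra.
Qed.

Lemma Series_finite_support (a : nat -> R) (n : nat) :
  (forall i, (n < i)%nat -> a i = 0) -> Series a = sum_f_R0 a n.
Proof.
  intros Ha; apply is_series_unique, is_series_Reals; intros eps He.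
  exists n; intros m Hm.
  replace (sum_f_R0 a m) with (sum_f_R0 a n); [now rewrite Rdist_eq|].
  induction Hm as [|m Hm IH]; [easy|]; simpl; rewrite Ha, Rplus_0_r by lia; exact IH.
Qed.

(** For the approximants the logarithmic derivative is the finite sum of [rho_i / (1 + rho_i y)].
    Tannery passes to the limit, where [rho_i] becomes [- / x i] and the term becomes
    [/ (y - x i)]. *)
Lemma dexp_log_derivative (q y : R) (x : nat -> R) :
  0 < q < 1 -> enumerates_zeros (fun y => dexp y q) x -> dexp y q <> 0 ->
  is_series (fun j => / (y - x j)) (dexp (q * y) q / dexp y q).
Proof.
  intros Hq Hx Hy.
  destruct (functional_choice (approx_roots q)) as [rho Hrho].
  { intros M; now apply approx_roots_exists. }
  assert (Hlim := fun k => approx_roots_limit q x rho k Hq Hx Hrho).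
  assert (Hneg := fun k => enumerates_zeros_neg _ _ k Hx).
  assert (Hne : forall k, y - x k <> 0).
  { intros k Hk; apply Hy; replace y with (x k) by lra.
    exact (enumerates_zeros_root _ _ k Hx). }
  (* From index [m] on, [q^n |y| <= 1/2], so the denominators are at least [1/2] and the terms at
     most [2 q^n]; the [+ 1] covers [y = 0]. *)
  destruct (pow_lt_1_zero q ltac:(rewrite Rabs_right; lra) (/ (2 * (Rabs y + 1))))
    as [m Hm].
  { assert (H := Rabs_pos y); apply Rinv_0_lt_compat; lra. }
  assert (Hgeom : ex_series (fun n => 2 * q ^ n)).
  { apply (ex_series_scal_l (V := R_NormedModule) 2), ex_series_geom.
    rewrite Rabs_right; lra. }
  destruct (tannery nat eventually (fun M i => rho M i / (1 + rho M i * y))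
    (fun i => / (y - x i)) (fun n => 2 * q ^ n) m Hgeom) as [Hex HS].
  - apply filter_forall; intros M n Hn.
    assert (H0 := approx_roots_nonneg q M _ n (Hrho M)).
    assert (H1 := approx_roots_le_pow q M _ n Hq (Hrho M)).
    assert (Hqm := Hm n Hn); assert (Hy0 := Rabs_pos y).
    assert (Hqn := pow_lt q n ltac:(lra)).
    rewrite Rabs_right in Hqm by lra.
    assert (Hqy : q ^ n * (2 * (Rabs y + 1)) < 1).
    { apply Rmult_lt_compat_r with (r := 2 * (Rabs y + 1)) in Hqm; [|lra].
      rewrite Rinv_l in Hqm; lra. }
    assert (Hry : Rabs (rho M n * y) <= 1 / 2).
    { rewrite Rabs_mult, (Rabs_right (rho M n)) by lra; nra. }
    apply Rabs_le_between in Hry.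
    assert (Hd : 0 < / (1 + rho M n * y) <= 2).
    { split; [apply Rinv_0_lt_compat; lra|].
      replace 2 with (/ (/ 2)) by field; apply Rinv_le_contravar; lra. }
    unfold Rdiv; rewrite Rabs_right by (apply Rle_ge, Rmult_le_pos; lra).
    rewrite (Rmult_comm 2); apply Rmult_le_compat; lra.
  - intros k; specialize (Hne k); specialize (Hneg k).
    replace (/ (y - x k)) with (- / x k / (1 + - / x k * y)) by (field; lra).
    apply (filterlim_R_div nat eventually); [|apply Hlim|].
    + intros H; apply Hne; apply Rmult_eq_reg_l with (- / x k).
      * replace (- / x k * (y - x k)) with (1 + - / x k * y) by (field; lra); lra.
      * apply Ropp_neq_0_compat, Rinv_neq_0_compat; lra.
    + apply (filterlim_R_plus nat eventually);
        [apply (filterlim_const (U := R_UniformSpace))|].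
      apply (filterlim_R_mult nat eventually);
        [apply Hlim|apply (filterlim_const (U := R_UniformSpace))].
  - assert (Hc : forall z, continuous (fun y => dexp y q) z)
      by (intros z; now apply continuous_dexp).
    assert (Hp := unif_limit_comp nat eventually _ _ (fun _ => y) y
      (dexp_approx_unif_limit q Hq) (Hc y) (filterlim_const (U := R_UniformSpace) y)).
    assert (Hp' := unif_limit_comp nat eventually _ _ (fun _ => q * y) (q * y)
      (dexp_approx_derive_unif_limit q Hq) (Hc (q * y))
      (filterlim_const (U := R_UniformSpace) (q * y))).
    assert (Hquot := filterlim_R_div nat eventually _ _ _ _ Hy Hp' Hp); simpl in Hquot.
    assert (Hp0 : eventually (fun M => dexp_poly q (S M) (y / INR (S M)) <> 0)).
    { assert (H := filterlim_R_gt nat eventually _ _ 0 (Rabs_pos_lt _ Hy)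
        (filterlim_R_abs nat eventually _ _ Hp)).
      revert H; apply filter_imp; intros M HM H0; rewrite H0, Rabs_R0 in HM; lra. }
    replace (dexp (q * y) q / dexp y q) with (Series (fun j => / (y - x j)));
      [now apply Series_correct|].
    apply (filterlim_locally_unique _ _ _ HS).
    revert Hquot; apply filterlim_ext_loc.
    revert Hp0; apply filter_imp; intros M HM.
    assert (Hfac := fun i => approx_roots_factor_neq_0 q y M _ i (Hrho M) HM).
    destruct (Hrho M) as [_ [H0 [_ [_ HP]]]].
    rewrite (Series_finite_support _ M) by (intros i Hi; rewrite H0 by exact Hi; field; lra).
    assert (HD : dexp_poly q M (q * y / INR (S M)) = dexp_poly q (S M) (y / INR (S M))
      * sum_f_R0 (fun i => rho M i / (1 + rho M i * y)) M).
    { rewrite HP, <- (is_derive_unique _ _ _ (is_derive_prod_first (rho M) M y Hfac)).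
      rewrite <- (is_derive_unique _ _ _ (is_derive_dexp_approx q y M)).
      apply Derive_ext, HP. }
    change (dexp_poly q M (q * y / INR (S M)) / dexp_poly q (S M) (y / INR (S M))
      = sum_f_R0 (fun i => rho M i / (1 + rho M i * y)) M).
    rewrite HD; field; exact HM.
Qed.

(** * Products with one factor left out *)

Lemma prod_except_ext (a b : nat -> R) (k n : nat) :
  (forall i, (i <> k)%nat -> a i = b i) -> prod_except a k n = prod_except b k n.
Proof.
  intros H; induction n as [|n IH]; simpl; [easy|]; rewrite IH.
  destruct (Nat.eqb_spec n k) as [_|Hne]; [easy|]; now rewrite H.
Qed.

Lemma prod_except_div (a b : nat -> R) (k n : nat) :
  prod_except (fun i => a i / b i) k n = prod_except a k n / prod_except b k n.
Proof.
  induction n as [|n IH]; simpl; [field|]; rewrite IH; unfold Rdiv.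
  rewrite Rinv_mult; destruct (Nat.eqb n k); [rewrite Rinv_1|]; ring.
Qed.

Lemma prod_first_except (a : nat -> R) (k n : nat) :
  (k < n)%nat -> prod_first a n = a k * prod_except a k n.
Proof.
  assert (Hle : forall n, (n <= k)%nat -> prod_except a k n = prod_first a n).
  { clear n; induction n as [|n IH]; intros Hn; simpl; [easy|].
    rewrite IH by lia; destruct (Nat.eqb_spec n k); [lia|easy]. }
  intros Hk; induction Hk as [|n Hk IH]; simpl.
  - rewrite Nat.eqb_refl, Hle by lia; ring.
  - rewrite IH; destruct (Nat.eqb_spec n k); [lia|ring].
Qed.

Lemma filterlim_prod_except (T : Type) (F : (T -> Prop) -> Prop) {FF : Filter F}
  (a : T -> nat -> R) (l : nat -> R) (k n : nat) :
  (forall i, filterlim (fun t => a t i) F (locally (l i))) ->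
  filterlim (fun t => prod_except (a t) k n) F (locally (prod_except l k n)).
Proof.
  intros H; induction n as [|n IH]; simpl.
  - apply (filterlim_const (U := R_UniformSpace)).
  - apply (filterlim_R_mult T F); [exact IH|].
    destruct (Nat.eqb n k); [apply (filterlim_const (U := R_UniformSpace))|apply H].
Qed.

Lemma ex_derive_prod_except (r : nat -> R) (k n : nat) (x : R) :
  ex_derive (fun y => prod_except (fun i => 1 + r i * y) k n) x.
Proof.
  induction n as [|n IH]; simpl.
  - apply (ex_derive_const (K := R_AbsRing) (V := R_NormedModule)).
  - apply (ex_derive_mult (fun y => prod_except (fun i => 1 + r i * y) k n)
      (fun y => if Nat.eqb n k then 1 else 1 + r n * y)); [exact IH|].
    destruct (Nat.eqb n k).
    + apply (ex_derive_const (K := R_AbsRing) (V := R_NormedModule)).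
    + auto_derive; easy.
Qed.

(** Each factor is at most [1 + B q^i <= exp(B q^i)]; the induction keeps the partial geometric sum
    in the exponent. *)
Lemma prod_except_bound (q B : R) (a : nat -> R) (k n : nat) :
  0 < q < 1 -> (forall i, Rabs (a i - 1) <= B * q ^ i) ->
  Rabs (prod_except a k n) <= exp (B / (1 - q)).
Proof.
  intros Hq Ha.
  assert (HB : 0 <= B).
  { assert (H := Ha 0%nat); assert (H' := Rabs_pos (a 0%nat - 1)); simpl in H; lra. }
  assert (H : Rabs (prod_except a k n) <= exp (B * (1 - q ^ n) / (1 - q))).
  { induction n as [|n IH]; simpl.
    - rewrite Rabs_R1; right; replace (B * (1 - 1) / (1 - q)) with 0 by (field; lra).
      now rewrite exp_0.
    - rewrite Rabs_mult.
      replace (B * (1 - q * q ^ n) / (1 - q)) with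
        (B * (1 - q ^ n) / (1 - q) + B * q ^ n) by (field; lra).
      rewrite exp_plus; apply Rmult_le_compat; try apply Rabs_pos; [exact IH|].
      assert (Hqn := pow_lt q n ltac:(lra)).
      eapply Rle_trans; [|apply exp_ineq1_le].
      destruct (Nat.eqb n k); [rewrite Rabs_R1; nra|].
      specialize (Ha n); replace (a n) with (1 + (a n - 1)) by ring.
      eapply Rle_trans; [apply Rabs_triang|]; rewrite Rabs_R1; lra. }
  eapply Rle_trans; [exact H|].
  assert (Hexp : forall u v, u <= v -> exp u <= exp v).
  { intros u v [Huv| ->]; [left; now apply exp_increasing|apply Rle_refl]. }
  apply Hexp.
  unfold Rdiv; apply Rmult_le_compat_r; [left; apply Rinv_0_lt_compat; lra|].
  assert (Hqn := pow_lt q n ltac:(lra)); nra.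
Qed.

(** Telescoping: passing from [m] to [m + 1] factors changes the product by at most [K B q^m]. The
    bound depends on [a] only through [B], so it is uniform over the approximants. *)
Lemma prod_except_tail (q B : R) (a : nat -> R) (k n m : nat) :
  0 < q < 1 -> (forall i, Rabs (a i - 1) <= B * q ^ i) -> (n <= m)%nat ->
  Rabs (prod_except a k m - prod_except a k n)
    <= exp (B / (1 - q)) * B / (1 - q) * q ^ n.
Proof.
  intros Hq Ha Hnm.
  set (K := exp (B / (1 - q))).
  assert (HB : 0 <= B).
  { assert (H := Ha 0%nat); assert (H' := Rabs_pos (a 0%nat - 1)); simpl in H; lra. }
  assert (HK : 0 < K) by apply exp_pos.
  assert (HC : 0 <= K * B / (1 - q)).
  { apply Rmult_le_pos; [nra|left; apply Rinv_0_lt_compat; lra]. }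
  assert (H : Rabs (prod_except a k m - prod_except a k n)
    <= K * B / (1 - q) * (q ^ n - q ^ m)).
  { induction Hnm as [|m Hnm IH].
    - rewrite !Rminus_diag, Rabs_R0; lra.
    - replace (prod_except a k (S m) - prod_except a k n) with
        ((prod_except a k (S m) - prod_except a k m)
          + (prod_except a k m - prod_except a k n)) by ring.
      eapply Rle_trans; [apply Rabs_triang|].
      assert (Hstep : Rabs (prod_except a k (S m) - prod_except a k m) <= K * (B * q ^ m)).
      { simpl; replace (_ - _) with
          (prod_except a k m * ((if Nat.eqb m k then 1 else a m) - 1)) by ring.
        rewrite Rabs_mult; apply Rmult_le_compat; try apply Rabs_pos.
        - now apply prod_except_bound.
        - destruct (Nat.eqb m k); [|apply Ha].
          assert (Hqm := pow_lt q m ltac:(lra)); rewrite Rminus_diag, Rabs_R0; nra. }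
      replace (K * B / (1 - q) * (q ^ n - q ^ S m)) with
        (K * (B * q ^ m) + K * B / (1 - q) * (q ^ n - q ^ m)) by (simpl; field; lra).
      lra. }
  eapply Rle_trans; [exact H|]; apply Rmult_le_compat_l; [exact HC|].
  assert (Hqm := pow_lt q m ltac:(lra)); lra.
Qed.

(** Interchange of limits: for fixed [n] let [M] grow in the uniform tail bound between [n] and
    [S M] factors, then let [n] grow. The point [u M] may move with [M], and [B = |y| + 1]
    eventually bounds it. *)
Lemma approx_prod_except_limit (q y L : R) (x : nat -> R) (rho : nat -> nat -> R)
  (u : nat -> R) (k : nat) :
  0 < q < 1 -> enumerates_zeros (fun y => dexp y q) x ->
  (forall M, approx_roots q M (rho M)) ->
  filterlim u eventually (locally y) ->
  filterlim (fun M => prod_except (fun i => 1 + rho M i * u M) k (S M)) eventually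
    (locally L) ->
  is_lim_seq (fun n => prod_except (fun i => 1 + - / x i * y) k n) L.
Proof.
  intros Hq Hx Hrho Hu HL.
  set (B := Rabs y + 1).
  set (C := exp (B / (1 - q)) * B / (1 - q)).
  assert (Hb : forall n, Rabs (prod_except (fun i => 1 + - / x i * y) k n - L) <= C * q ^ n).
  { intros n; rewrite Rabs_minus_sym.
    apply (filterlim_R_le nat eventually (fun M => Rabs (
      prod_except (fun i => 1 + rho M i * u M) k (S M)
      + - prod_except (fun i => 1 + rho M i * u M) k n))).
    - assert (HuB := filterlim_R_lt nat eventually _ (Rabs y) B ltac:(unfold B; lra)
        (filterlim_R_abs nat eventually _ _ Hu)).
      generalize (filter_and _ _ HuB (eventually_ge n)); apply filter_imp.
      intros M [HM HnM]; apply (prod_except_tail q B); [exact Hq| |lia].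
      intros i; replace (1 + rho M i * u M - 1) with (u M * rho M i) by ring.
      assert (H0 := approx_roots_nonneg q M _ i (Hrho M)).
      assert (H1 := approx_roots_le_pow q M _ i Hq (Hrho M)).
      rewrite Rabs_mult, (Rabs_right (rho M i)) by lra.
      apply Rmult_le_compat; [apply Rabs_pos|lra|lra|lra].
    - apply filterlim_R_abs; apply (filterlim_R_plus nat eventually); [exact HL|].
      apply filterlim_R_opp; apply (filterlim_prod_except nat eventually); intros i.
      apply (filterlim_R_plus nat eventually);
        [apply (filterlim_const (U := R_UniformSpace))|].
      apply (filterlim_R_mult nat eventually); [|exact Hu].
      now apply (approx_roots_limit q x). }
  apply is_lim_seq_ext with (fun n =>
    (prod_except (fun i => 1 + - / x i * y) k n - L) + L); [intros; ring|].
  replace (Finite L) with (Finite (0 + L)) by (f_equal; ring).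
  apply is_lim_seq_plus'; [|apply is_lim_seq_const].
  apply is_lim_seq_abs_0.
  apply (is_lim_seq_le_le (fun _ => 0) _ (fun n => C * q ^ n)).
  - intros n; split; [apply Rabs_pos|apply Hb].
  - apply is_lim_seq_const.
  - replace (Finite 0) with (Finite (C * 0)) by (f_equal; ring).
    apply (is_lim_seq_scal_l (fun n => q ^ n) C 0).
    apply is_lim_seq_geom; rewrite Rabs_right; lra.
Qed.

Lemma dexp_prod_except (q y : R) (x : nat -> R) (k : nat) :
  0 < q < 1 -> enumerates_zeros (fun y => dexp y q) x -> y <> x k ->
  is_lim_seq (fun n => prod_except (fun i => 1 + - / x i * y) k n)
    (dexp y q / (1 + - / x k * y)).
Proof.
  intros Hq Hx Hy.
  destruct (functional_choice (approx_roots q)) as [rho Hrho].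
  { intros M; now apply approx_roots_exists. }
  assert (Hxk := enumerates_zeros_neg _ _ k Hx).
  assert (Hfac : 1 + - / x k * y <> 0).
  { intros H; apply Hy; apply Rmult_eq_reg_l with (- / x k).
    - replace (- / x k * x k) with (-1) by (field; lra); lra.
    - apply Ropp_neq_0_compat, Rinv_neq_0_compat; lra. }
  assert (Hlin : filterlim (fun M => 1 + rho M k * y) eventually
    (locally (1 + - / x k * y))).
  { apply (filterlim_R_plus nat eventually); [apply (filterlim_const (U := R_UniformSpace))|].
    apply (filterlim_R_mult nat eventually);
      [now apply (approx_roots_limit q x)|apply (filterlim_const (U := R_UniformSpace))]. }
  apply (approx_prod_except_limit q y _ x rho (fun _ => y) k Hq Hx Hrho);
    [apply (filterlim_const (U := R_UniformSpace))|].
  assert (Hp := unif_limit_comp nat eventually _ _ (fun _ => y) y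
    (dexp_approx_unif_limit q Hq) (continuous_dexp q y Hq)
    (filterlim_const (U := R_UniformSpace) y)).
  assert (Hquot := filterlim_R_div nat eventually _ _ _ _ Hfac Hp Hlin).
  revert Hquot; apply filterlim_ext_loc.
  assert (Hne : eventually (fun M => 1 + rho M k * y <> 0)).
  { assert (H := filterlim_R_gt nat eventually _ _ 0 (Rabs_pos_lt _ Hfac)
      (filterlim_R_abs nat eventually _ _ Hlin)).
    revert H; apply filter_imp; intros M HM H0; rewrite H0, Rabs_R0 in HM; lra. }
  generalize (filter_and _ _ Hne (eventually_ge k)); apply filter_imp; intros M [HM HkM].
  destruct (Hrho M) as [_ [_ [_ [_ HP]]]].
  rewrite HP, (prod_first_except _ k) by lia; field; exact HM.
Qed.

(** At [x k] the omitted factor vanishes, so dividing by it fails. Each approximant is evaluated at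
    its own zero [z = - / rho M k] instead: with [P(y) = (1 + rho y) E(y)] one gets
    [P'(z) = rho E(z)], that is [E(z) = - z P'(z)], and this converges to [- x_k f'(x_k)]. *)
Lemma dexp_prod_except_at_zero (q : R) (x : nat -> R) (k : nat) :
  0 < q < 1 -> enumerates_zeros (fun y => dexp y q) x ->
  is_lim_seq (fun n => prod_except (fun i => 1 + - / x i * x k) k n)
    (- x k * dexp (q * x k) q).
Proof.
  intros Hq Hx.
  destruct (functional_choice (approx_roots q)) as [rho Hrho].
  { intros M; now apply approx_roots_exists. }
  assert (Hxk := enumerates_zeros_neg _ _ k Hx).
  assert (Hinv : filterlim (fun M => - / rho M k) eventually (locally (x k))).
  { replace (x k) with (- / - / x k) by (field; lra).
    apply filterlim_R_opp, filterlim_R_inv; [|now apply (approx_roots_limit q x)].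
    apply Ropp_neq_0_compat, Rinv_neq_0_compat; lra. }
  apply (approx_prod_except_limit q (x k) _ x rho (fun M => - / rho M k) k Hq Hx Hrho);
    [exact Hinv|].
  assert (Hqinv : filterlim (fun M => q * - / rho M k) eventually (locally (q * x k))).
  { apply (filterlim_R_mult nat eventually);
      [apply (filterlim_const (U := R_UniformSpace))|exact Hinv]. }
  assert (Hp' := unif_limit_comp nat eventually _ _ _ (q * x k)
    (dexp_approx_derive_unif_limit q Hq) (continuous_dexp q _ Hq) Hqinv).
  assert (H := filterlim_R_mult nat eventually _ _ _ _
    (filterlim_R_opp nat eventually _ _ Hinv) Hp').
  revert H; apply filterlim_ext_loc.
  generalize (eventually_ge k); apply filter_imp; intros M HM.
  destruct (Hrho M) as [Hpos [_ [_ [_ HP]]]]; specialize (Hpos k HM).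
  set (z := - / rho M k).
  set (E := fun y => prod_except (fun i => 1 + rho M i * y) k (S M)).
  destruct (ex_derive_prod_except (rho M) k (S M) z) as [dE HdE].
  assert (HD : dexp_poly q M (q * z / INR (S M)) = rho M k * E z + (1 + rho M k * z) * dE).
  { rewrite <- (is_derive_unique _ _ _ (is_derive_dexp_approx q z M)).
    rewrite (Derive_ext _ (fun y => (1 + rho M k * y) * E y)).
    - apply is_derive_unique.
      apply (is_derive_mult (K := R_AbsRing) (fun y => 1 + rho M k * y) E z);
        [|exact HdE|exact Rmult_comm].
      auto_derive; [easy|ring].
    - intros y; rewrite HP; apply (prod_first_except (fun i => 1 + rho M i * y)); lia. }
  rewrite HD.
  change (- z * (rho M k * E z + (1 + rho M k * z) * dE) = E z).
  unfold z at 1 3; field; lra.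
Qed.

(** * Dependence of the zeros on [q] *)

Lemma zeros_filterlim_q (x : nat -> R -> R) (q : R) (k : nat) :
  (forall t, 0 < t < 1 -> enumerates_zeros (fun y => dexp y t) (fun j => x j t)) ->
  0 < q < 1 -> filterlim (x k) (locally q) (locally (x k q)).
Proof.
  intros Hx Hq.
  (* The separation ratio at parameter [t] is [t] itself; staying below the midpoint of [q] and 1
     gives one ratio [s = (1 + q) / 2 < 1] for all nearby [t]. *)
  assert (Hnear : locally q (fun t => 0 < t < (1 + q) / 2)).
  { apply (open_and (fun t => 0 < t) (fun t => t < (1 + q) / 2));
      [apply open_gt|apply open_lt|lra]. }
  apply (separated_zeros_filterlim R (locally q) (fun t y => dexp y t)
    (fun y => dexp y q) (fun y => dexp (q * y) q) x (fun j => x j q) ((1 + q) / 2)).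
  - intros A eps He; now apply dexp_filterlim_unif.
  - revert Hnear; apply filter_imp; intros t Ht y.
    apply derivable_continuous_pt; eexists.
    apply is_derive_Reals, is_derive_dexp; lra.
  - intros y; now apply is_derive_dexp.
  - intros i; apply (zeros_simple q (fun j => x j q)); auto.
  - now apply Hx.
  - rewrite dexp_0; lra.
  - lra.
  - revert Hnear; apply filter_imp; intros t Ht; apply Hx; lra.
  - intros i; revert Hnear; apply filter_imp; intros t Ht.
    assert (Hxt := Hx t ltac:(lra)).
    assert (H := zeros_separated t (fun j => x j t) i ltac:(lra) Hxt).
    assert (Hn := enumerates_zeros_neg _ _ i Hxt); simpl in H, Hn.
    assert (Hinv : / ((1 + q) / 2) <= / t) by (apply Rinv_le_contravar; lra).
    unfold Rdiv at 1 in H; unfold Rdiv at 1; nra.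
  - intros i; revert Hnear; apply filter_imp; intros t Ht.
    exact (enumerates_zeros_root _ _ i (Hx t ltac:(lra))).
  - revert Hnear; apply filter_imp; intros t Ht y Hy.
    destruct (Hx t ltac:(lra)) as [_ [Hd Hz]]; apply Hz in Hy; destruct Hy as [j <-].
    apply (decreasing_le (fun j => x j t)); [exact Hd|lia].
  - intros i; revert Hnear; apply filter_imp; intros t Ht y Hy.
    exact (enumerates_zeros_gap _ _ i y (Hx t ltac:(lra)) Hy).
Qed.

Lemma is_derive_of_quotient (h : R -> R) (q l : R) :
  filterlim (fun t => (h t - h q) / (t - q)) (locally' q) (locally l) ->
  is_derive h q l.
Proof.
  intros H; apply is_derive_Reals; intros eps He.
  destruct (proj1 (filterlim_R_eps R (locally' q) _ _) H eps He) as [delta Hd].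
  exists delta; intros e He0 Hed.
  replace e with (q + e - q) at 2 by ring.
  apply Hd; [|lra].
  unfold ball; simpl; unfold AbsRing_ball, abs, minus, plus, opp; simpl.
  now replace (q + e + - q) with e by ring.
Qed.

(* Implicit differentiation of [f(x_k(t); t) = 0], with the difference quotient
   in [x] controlled by the mean value theorem. *)
Lemma is_derive_zero (x : nat -> R -> R) (q : R) (k : nat) :
  (forall t, 0 < t < 1 -> enumerates_zeros (fun y => dexp y t) (fun j => x j t)) ->
  0 < q < 1 ->
  is_derive (x k) q
    (- (x k q ^ 2 / 2 * dexp (q ^ 2 * x k q) q) / dexp (q * x k q) q).
Proof.
  intros Hx Hq.
  set (c := x k q); set (L := dexp (q * c) q).
  assert (HL : L <> 0) by exact (zeros_simple q (fun j => x j q) k Hq (Hx q Hq)).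
  assert (Hc0 : dexp c q = 0) by exact (enumerates_zeros_root _ _ k (Hx q Hq)).
  assert (Hcont := zeros_filterlim_q x q k Hx Hq); fold c in Hcont.
  (* Slope of [dexp _ t] between [c] and [x k t]. The value [L] in the degenerate case keeps [A]
     convergent to [L] and preserves [A t * (x k t - c) = - dexp c t]. *)
  set (A := fun t => if Req_EM_T (x k t) c then L
    else (dexp (x k t) t - dexp c t) / (x k t - c)).
  assert (HA : filterlim A (locally q) (locally L)).
  { apply (filterlim_R_eps R (locally q)); intros eps He.
    assert (Hcd := proj1 (filterlim_R_eps R (locally (q * c)) _ _)
      (continuous_dexp q (q * c) Hq) (eps / 2) ltac:(lra)).
    destruct Hcd as [delta Hdelta].
    assert (Hd := cond_pos delta).
    assert (H1 := dexp_filterlim_unif q (Rabs c + 1) (eps / 2) Hq ltac:(lra)).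
    assert (H2 := proj1 (filterlim_R_eps R (locally q) _ _) Hcont
      (Rmin 1 (delta / 2)) ltac:(apply Rmin_pos; lra)).
    assert (Htc : filterlim (fun t => t * c) (locally q) (locally (q * c))).
    { apply (filterlim_R_mult R (locally q)); [apply filterlim_id|].
      apply (filterlim_const (U := R_UniformSpace)). }
    assert (H3 := proj1 (filterlim_R_eps R (locally q) _ _) Htc (delta / 2) ltac:(lra)).
    generalize (filter_and _ _ (locally_unit_interval q Hq)
      (filter_and _ _ H1 (filter_and _ _ H2 H3))); apply filter_imp.
    intros t [Ht [Ht1 [Ht2 Ht3]]]; unfold A.
    destruct (Req_EM_T (x k t) c) as [_|Hne]; [rewrite Rminus_diag, Rabs_R0; exact He|].
    (* The slope equals [dexp (t * xi) t] with [xi] between [c] and [x k t]. Half of [eps] pays for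
       changing the parameter [t] to [q], half for moving [t * xi] to [q * c]. *)
    destruct (MVT_gen (fun y => dexp y t) c (x k t) (fun y => dexp (t * y) t))
      as [xi [Hxi Hmvt]].
    { intros y _; now apply is_derive_dexp. }
    { intros y _; apply continuity_pt_filterlim, continuous_dexp, Ht. }
    replace ((dexp (x k t) t - dexp c t) / (x k t - c)) with (dexp (t * xi) t)
      by (rewrite Hmvt; field; lra).
    assert (Hxi' : Rabs (xi - c) < Rmin 1 (delta / 2)).
    { eapply Rle_lt_trans; [|exact Ht2].
      unfold Rmin, Rmax in Hxi; destruct (Rle_dec c (x k t)).
      - rewrite !Rabs_right; lra.
      - rewrite !Rabs_left1; lra. }
    assert (Hm1 := Rmin_l 1 (delta / 2)); assert (Hm2 := Rmin_r 1 (delta / 2)).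
    assert (Hxi1 : Rabs xi <= Rabs c + 1).
    { replace xi with (c + (xi - c)) by ring.
      eapply Rle_trans; [apply Rabs_triang|]; lra. }
    assert (Htxi : Rabs (t * xi) <= Rabs c + 1).
    { rewrite Rabs_mult, (Rabs_right t) by lra; assert (H := Rabs_pos xi); nra. }
    assert (Hball : Rabs (t * xi - q * c) < delta).
    { replace (t * xi - q * c) with (t * (xi - c) + (t * c - q * c)) by ring.
      eapply Rle_lt_trans; [apply Rabs_triang|].
      rewrite Rabs_mult, (Rabs_right t) by lra; assert (H := Rabs_pos (xi - c)); nra. }
    assert (Hfin1 := Ht1 _ Htxi); assert (Hfin2 := Hdelta _ Hball).
    fold L in Hfin2.
    apply Rabs_def2 in Hfin1; apply Rabs_def2 in Hfin2; apply Rabs_def1; lra. }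
  apply is_derive_of_quotient; fold c.
  assert (Hsub : filterlim A (locally' q) (locally L)).
  { intros P HP; specialize (HA P HP); unfold filtermap, locally', within in *.
    revert HA; apply filter_imp; auto. }
  assert (HQ := dexp_quotient_q_filterlim q c Hq).
  assert (Hlim := filterlim_R_div R (locally' q) _ _ _ _ HL
    (filterlim_R_opp R (locally' q) _ _ HQ) Hsub).
  revert Hlim; apply filterlim_ext_loc.
  assert (HA0 := filterlim_R_gt R (locally' q) _ _ 0 (Rabs_pos_lt _ HL)
    (filterlim_R_abs R (locally' q) _ _ Hsub)).
  assert (Hnear : locally' q (fun t => 0 < t < 1 /\ t <> q)).
  { unfold locally', within; generalize (locally_unit_interval q Hq).
    apply filter_imp; tauto. }
  generalize (filter_and _ _ HA0 Hnear); apply filter_imp.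
  intros t [HAt [Ht Htq]].
  assert (HAt0 : A t <> 0) by (intros H; rewrite H, Rabs_R0 in HAt; lra).
  assert (Hx0 : dexp (x k t) t = 0) by exact (enumerates_zeros_root _ _ k (Hx t Ht)).
  assert (HAeq : A t * (x k t - c) = - dexp c t).
  { unfold A; destruct (Req_EM_T (x k t) c) as [Heq|Hne].
    - rewrite Heq in *; rewrite Hx0; ring.
    - rewrite Hx0; field; lra. }
  rewrite Hc0; replace (dexp c t) with (- (A t * (x k t - c))) by lra.
  field; split; [lra|exact HAt0].
Qed.

(* x k q is the paper's x_{k+1}(q) (0-based indexing). *)
Theorem theorem2 (x : nat -> R -> R)
  (Hzeros : forall q, 0 < q < 1 ->
     x 0%nat q < 0 /\
     (forall k, x (S k) q < x k q) /\
     (forall y, dexp y q = 0 <-> exists k, x k q = y)) :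
  forall (k : nat) (q : R), 0 < q < 1 ->
    ex_series (fun j => / (x j q - q * x k q)) /\
    is_derive (fun t => x k t) q
      (x k q ^ 2 / 2 * Series (fun j => / (x j q - q * x k q))) /\
    is_series (fun j => / (x k q - q * x j q)) 0 /\
    is_prod_except (fun j => (x j q - x k q) / (x j q - q * x k q)) k
      ((q - 1) * x k q).
Proof.
  intros k q Hq.
  assert (Hx : enumerates_zeros (fun y => dexp y q) (fun j => x j q)) by now apply Hzeros.
  assert (Hneg := fun j => enumerates_zeros_neg _ _ j Hx); simpl in Hneg.
  assert (Hroot := fun j => enumerates_zeros_root _ _ j Hx); simpl in Hroot.
  assert (HL := fun j => zeros_simple q _ j Hq Hx); simpl in HL.
  assert (Hk := Hneg k).
  assert (Hser : is_series (fun j => / (x j q - q * x k q))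
    (- (dexp (q * (q * x k q)) q / dexp (q * x k q) q))).
  { assert (H := is_series_opp (V := R_NormedModule) _ _
      (dexp_log_derivative q (q * x k q) _ Hq Hx (HL k))).
    revert H; apply is_series_R_ext; intros j.
    change (- / (q * x k q - x j q) = / (x j q - q * x k q)).
    rewrite <- Rinv_opp; f_equal; ring. }
  split; [now eexists; exact Hser|]; split; [|split].
  - rewrite (is_series_unique _ _ Hser).
    replace (x k q ^ 2 / 2 * - (dexp (q * (q * x k q)) q / dexp (q * x k q) q)) with
      (- (x k q ^ 2 / 2 * dexp (q ^ 2 * x k q) q) / dexp (q * x k q) q).
    + apply is_derive_zero; [exact Hzeros|exact Hq].
    + replace (q ^ 2 * x k q) with (q * (q * x k q)) by ring; field; apply HL.
  (* A zero at [x_k / q] would be multiple, the derivative there being [f(x_k) = 0]. *)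
  - assert (Hy : dexp (x k q / q) q <> 0).
    { intros H0; apply (proj2 (proj2 Hx)) in H0; destruct H0 as [j Hj].
      apply (HL j); rewrite Hj; replace (q * (x k q / q)) with (x k q) by (field; lra).
      apply Hroot. }
    assert (H := is_series_scal (V := R_NormedModule) (/ q) _ _
      (dexp_log_derivative q (x k q / q) _ Hq Hx Hy)).
    replace (q * (x k q / q)) with (x k q) in H by (field; lra); rewrite Hroot in H.
    replace 0 with (/ q * (0 / dexp (x k q / q) q)) by (field; split; [exact Hy|lra]).
    revert H; apply is_series_R_ext; intros j.
    change (/ q * / (x k q / q - x j q) = / (x k q - q * x j q)).
    rewrite <- Rinv_mult; f_equal; field; lra.
  - assert (Hden : forall j, x j q - q * x k q <> 0).
    { intros j Hj; apply (HL k); replace (q * x k q) with (x j q) by lra; apply Hroot. }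
    assert (H1 := dexp_prod_except_at_zero q _ k Hq Hx).
    assert (H2 := dexp_prod_except q (q * x k q) _ k Hq Hx ltac:(simpl; nra)).
    simpl in H1, H2.
    (* The factor omitted at [q x_k] is [1 - q]. The quotient of the two limits is thus [- x_k f(q
       x_k) / (f(q x_k) / (1 - q)) = (q - 1) x_k]. *)
    replace (1 + - / x k q * (q * x k q)) with (1 - q) in H2 by (field; lra).
    assert (Hd : dexp (q * x k q) q / (1 - q) <> 0).
    { apply Rmult_integral_contrapositive_currified; [apply HL|].
      apply Rinv_neq_0_compat; lra. }
    assert (H := is_lim_seq_div' _ _ _ _ H1 H2 Hd).
    unfold is_prod_except.
    replace ((q - 1) * x k q) with
      (- x k q * dexp (q * x k q) q / (dexp (q * x k q) q / (1 - q)))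
      by (field; split; [lra|apply HL]).
    revert H; apply is_lim_seq_ext; intros n.
    rewrite <- prod_except_div; apply prod_except_ext; intros j Hj.
    specialize (Hneg j); specialize (Hden j); field; repeat split; lra.
Qed.
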